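(* Let $\mathbb{X}$ and $\mathbb{Y}$ be compact subsets of $\mathbb{R}^n$ with non-empty interior, and let $c:\mathbb{X}\times\mathbb{Y}\to\mathbb{R}$ be a $C^2$ function (in the sense that $D_xc$, $D_yc$, $D^2_{xy}c$, $D^2_{yx}c$ exist and are continuous on $\mathbb{X}\times\mathbb{Y}$ and $D^2_{xy}c=(D^2_{yx}c)^T$) which is bi-twisted and non-degenerate. Assume that $\mathbb{X}$ is $c$-convex with respect to $\mathbb{Y}$ and $\mathbb{Y}$ is $c$-convex with respect to $\mathbb{X}$. Then: (1) If $c$ satisfies Loeper's property, then a function $\phi:\mathbb{X}\to\mathbb{R}$ is $c$-convex if and only if it is alternative $c$-convex. (2) If $c$ does not satisfy Loeper's property, then there exists a function $\phi:\mathbb{X}\to\mathbb{R}$ that is alternative $c$-convex but not $c$-convex.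
   Context: Bi-twist: for each $x\in\mathbb{X}$ the map $y\mapsto -D_xc(x,y)$ is injective on $\mathbb{Y}$, and for each $y\in\mathbb{Y}$ the map $x\mapsto -D_yc(x,y)$ is injective on $\mathbb{X}$. Non-degenerate: $D^2_{xy}c(x,y)$ is invertible for every $(x,y)\in\mathbb{X}\times\mathbb{Y}$. For $y\in\mathbb{Y}$ let $[\mathbb{X}]_y=\{-D_yc(x,y):x\in\mathbb{X}\}$ and for $x\in\mathbb{X}$ let $[\mathbb{Y}]_x=\{-D_xc(x,y):y\in\mathbb{Y}\}$; $\mathbb{X}$ is $c$-convex with respect to $\mathbb{Y}$ if $[\mathbb{X}]_y$ is convex for every $y\in\mathbb{Y}$, and $\mathbb{Y}$ is $c$-convex with respect to $\mathbb{X}$ if $[\mathbb{Y}]_x$ is convex for every $x\in\mathbb{X}$. For $y\in\mathbb{Y}$, $\exp^c_y:[\mathbb{X}]_y\to\mathbb{X}$ denotes the inverse of $x\mapsto -D_yc(x,y)$. For $x_0,x_1\in\mathbb{X}$, $y\in\mathbb{Y}$, $p_i=-D_yc(x_i,y)$, the $c$-segment with respect to $y$ from $x_0$ to $x_1$ is $\{x_t=\exp^c_y(tp_1+(1-t)p_0): t\in[0,1]\}$. Loeper's property: for all $x_0,x_1\in\mathbb{X}$, $y_0,y\in\mathbb{Y}$ and every point $x_t$ of the $c$-segment with respect to $y_0$ from $x_0$ to $x_1$, one has $-c(x_t,y)+c(x_t,y_0)\le\max\{-c(x_i,y)+c(x_i,y_0): i=0,1\}$. $c$-convex function: $\phi:\mathbb{X}\to\mathbb{R}$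 is $c$-convex if $\phi(x)=\sup_{y\in\mathbb{Y}}\{-c(x,y)+\psi(y)\}$ for some $\psi:\mathbb{Y}\to\mathbb{R}\cup\{-\infty\}$ not identically $-\infty$. $c$-chord: for $X_i=(x_i,u_i)\in\mathbb{X}\times\mathbb{R}$, $i=0,1$, $F_{X_0X_1}(x)=\sup\{-c(x,y)+h: y\in\mathbb{Y}, h\in\mathbb{R}, -c(x_i,y)+h\le u_i \text{ for } i=0,1\}$ for $x\in\mathbb{X}$. Alternative $c$-convex: $\phi:\mathbb{X}\to\mathbb{R}$ is alternative $c$-convex if for all $x_0,x_1\in\mathbb{X}$, with $X_i=(x_i,\phi(x_i))$, one has $\phi(x)\le F_{X_0X_1}(x)$ for all $x\in\mathbb{X}$. *)

(* Defs.v *)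
From HB Require Import structures.
From mathcomp Require Import all_boot all_order all_algebra.
From mathcomp Require Import all_classical all_reals all_analysis.
Set Implicit Arguments. Unset Strict Implicit. Unset Printing Implicit Defensive.
Import Order.TTheory GRing.Theory Num.Theory.
Import numFieldNormedType.Exports.
Local Open Scope classical_set_scope.
Local Open Scope ring_scope.

(* Points of R^n are row vectors 'rV[R]_n.  The cost c is a function
   'rV_n -> 'rV_n -> R; only its values (and derivatives) on X x Y matter. *)

Section Defs.
Variables (R : realType) (n : nat).
Notation V := 'rV[R]_n.
Implicit Types (X Y : set V) (c : V -> V -> R).

Definition gradx c (x y : V) : V := \row_i ('d (fun x' : V => c x' y) x (delta_mx 0 i)).
Definition grady c (x y : V) : V := \row_j ('d (fun y' : V => c x y') y (delta_mx 0 j)).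

Definition Dxy c (x y : V) : 'M[R]_n :=
  \matrix_(i, j) ('d (fun y' : V => gradx c x y' 0 i) y (delta_mx 0 j)).
Definition Dyx c (x y : V) : 'M[R]_n :=
  \matrix_(j, i) ('d (fun x' : V => grady c x' y 0 j) x (delta_mx 0 i)).

Definition C2_on X Y c : Prop :=
  [/\ (forall x y, X x -> Y y -> differentiable (fun x' : V => c x' y) x),
      (forall x y, X x -> Y y -> differentiable (fun y' : V => c x y') y),
      (forall x y, X x -> Y y -> differentiable (fun y' : V => gradx c x y') y),
      (forall x y, X x -> Y y -> differentiable (fun x' : V => grady c x' y) x) &
    [/\ {within X `*` Y, continuous (fun p : V * V => gradx c p.1 p.2)},
      {within X `*` Y, continuous (fun p : V * V => grady c p.1 p.2)},
      {within X `*` Y, continuous (fun p : V * V => Dxy c p.1 p.2)},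
      {within X `*` Y, continuous (fun p : V * V => Dyx c p.1 p.2)} &
      (forall x y, X x -> Y y -> Dxy c x y = (Dyx c x y)^T)]].

Definition bi_twist X Y c : Prop :=
  (forall x, X x -> forall y1 y2, Y y1 -> Y y2 ->
     - gradx c x y1 = - gradx c x y2 -> y1 = y2) /\
  (forall y, Y y -> forall x1 x2, X x1 -> X x2 ->
     - grady c x1 y = - grady c x2 y -> x1 = x2).

Definition non_degenerate X Y c : Prop :=
  forall x y, X x -> Y y -> Dxy c x y \in unitmx.

Definition cimX X c (y : V) : set V := [set - grady c x y | x in X].
Definition cimY Y c (x : V) : set V := [set - gradx c x y | y in Y].

Definition c_convex_wrt_X X Y c : Prop :=
  forall y, Y y -> convex_set (cimX X c y : set (convex_lmodType V)).
Definition c_convex_wrt_Y X Y c : Prop :=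
  forall x, X x -> convex_set (cimY Y c x : set (convex_lmodType V)).

(* xt lies on the c-segment w.r.t. y from x0 to x1, i.e.
   xt = exp^c_y (t p1 + (1-t) p0) for some t in [0,1], where
   exp^c_y is the inverse of x |-> -D_y c(x,y) on X. *)
Definition c_segment X c (y x0 x1 xt : V) : Prop :=
  X xt /\ exists t : R, 0 <= t <= 1 /\
    - grady c xt y = t *: (- grady c x1 y) + (1 - t) *: (- grady c x0 y).

Definition Loeper X Y c : Prop :=
  forall x0 x1 y0 y xt, X x0 -> X x1 -> Y y0 -> Y y ->
    c_segment X c y0 x0 x1 xt ->
    - c xt y + c xt y0 <= Num.max (- c x0 y + c x0 y0) (- c x1 y + c x1 y0).

Definition c_convex_fun X Y c (phi : V -> R) : Prop :=
  exists psi : V -> \bar R,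
    (forall y, Y y -> psi y != +oo%E) /\ (exists y, Y y /\ psi y != -oo%E) /\
    forall x, X x ->
      (phi x)%:E = ereal_sup [set ((- c x y)%:E + psi y)%E | y in Y].

Definition c_chord Y c (x0 : V) (u0 : R) (x1 : V) (u1 : R) (x : V) : \bar R :=
  ereal_sup [set r : \bar R | exists (y : V) (h : R),
                 [/\ Y y, - c x0 y + h <= u0, - c x1 y + h <= u1 &
                      r = (- c x y + h)%:E]].

Definition alt_c_convex_fun X Y c (phi : V -> R) : Prop :=
  forall x0 x1, X x0 -> X x1 -> forall x, X x ->
    ((phi x)%:E <= c_chord Y c x0 (phi x0) x1 (phi x1) x)%E.

End Defs.

(* Main.v *)
(* Write [l y x = - c x y + c xb y] for the c-affine function of slope [y]
   vanishing at [xb].  Both Loeper's property and its dual are equivalent to one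
   first-order condition ([cross_condition]): if
   [- c x y + c x y0 + c xb y - c xb y0 <= 0], then the derivative of this cross
   difference at [x = xb] along the c-segment with respect to [y0], which is also
   its derivative at [y = y0] along the c-segment with respect to [xb], is
   nonpositive.

   Under Loeper's property, let [phi] be alternative c-convex.  By compactness
   it suffices to support [phi] at [xb] against finitely many points; take the
   slope [yb] maximising the smallest of the supporting margins.  Optimality
   and a bilinear minimax argument give a point [xs] in the c-convex hull of the
   active points such that the derivative above is nonnegative for every slope,
   so by the first-order condition [yb] maximises [c xs y - c xb y].  Sublevel
   sets of [phi + c(., yb)] are c-convex, hence contain [xs], and the chord with
   both ends at [xs] shows that [yb] supports [phi].

   If Loeper's property fails, there are [xb], [x1] and a slope [y0] in the
   interior of the c-segment between two slopes with [l] at [x1] strictly larger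
   for [y0] than for slopes near the two ends.  Let [Phi] be the maximum of
   finitely many [l y] with [y] near the ends, relative to [l y0].  Then [Phi] is
   positive near [xb], except at [xb], and negative at [x1].  Replacing [Phi] by
   [max Phi ep] near [xb] keeps the two-point condition: two constraints near
   [xb] are met by [y0], and one constraint near [xb] together with a remote
   one, or two remote ones, by one of the end slopes.  But near [xb] the only
   candidate c-subgradient is [y0], which fails at [x1]. *)
Require Import Defs.
From HB Require Import structures.
From mathcomp Require Import all_boot all_order all_algebra.
From mathcomp Require Import all_classical all_reals all_analysis.
From mathcomp Require Import ring lra.
Import Order.TTheory GRing.Theory Num.Theory.
Import numFieldNormedType.Exports.
Local Open Scope classical_set_scope.
Local Open Scope ring_scope.

Set Implicit Arguments.
Unset Strict Implicit.
Unset Printing Implicit Defensive.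

(** * Compactness and convexity *)

Section Compactness.

(** Heine-Borel with each [P i] required only on a relative neighbourhood in [K]. Were no finite
    list enough, the supersets of [K] minus finitely many [P i] would form a proper filter, and the
    local cover at one of its cluster points gives a contradiction. *)
Lemma compact_finite_cover (T : topologicalType) (I : choiceType) (K : set T)
    (D : set I) (P : I -> T -> Prop) : compact K ->
    (forall w, K w -> exists2 i, D i & \forall w' \near w, K w' -> P i w') ->
  exists2 l : seq I, (forall i, i \in l -> D i) &
    forall w, K w -> exists2 i, i \in l & P i w.
Proof.
move=> cK HP; apply: contrapT => Hno.
pose F : set_system T := fun S => exists2 l : seq I, (forall i, i \in l -> D i) &
  forall w, K w -> (forall i, i \in l -> ~ P i w) -> S w.
have FF : ProperFilter F.
  split.
    case=> l Dl Hl; apply: Hno; exists l => // w Kw.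
    apply: contrapT => Hw; apply: (Hl w) => // i il Pi.
    by apply: Hw; exists i.
  split.
  - by exists [::].
  - move=> S1 S2 [l1 D1 H1] [l2 D2 H2]; exists (l1 ++ l2).
      by move=> i; rewrite mem_cat => /orP[/D1|/D2].
    by move=> w Kw Hw; split; [apply: H1|apply: H2] => // i il; apply: Hw;
      rewrite mem_cat il ?orbT.
  - by move=> S1 S2 S12 [l Dl Hl]; exists l => // w Kw Hw; apply/S12/Hl.
have FK : F K by exists [::].
have [w [Kw Cw]] := cK F FF FK.
have [i Di Hi] := HP w Kw.
have FN : F [set w' | K w' /\ ~ P i w'].
  exists [:: i] => [j|w' Kw' Hw']; first by rewrite inE => /eqP ->.
  by split=> //; apply: Hw'; rewrite inE.
by have [w' [[Kw' nP] /(_ Kw')]] := Cw _ _ FN Hi.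
Qed.

(** If no maximum is attained, the sets where [f] is below one of its own values cover [K]; a point
    with the largest value in a finite subcover then belongs to none of its sets. *)
Lemma usc_compact_max (R : realType) (T : topologicalType) (K : set T)
    (f : T -> R) : compact K -> K !=set0 ->
    (forall v b, K v -> f v < b -> \forall v' \near v, K v' -> f v' < b) ->
  exists2 v, K v & forall v', K v' -> f v' <= f v.
Proof.
move=> cK [v0 Kv0] usc; apply: contrapT => Hno.
have Hno' v : K v -> exists2 v', K v' & f v < f v'.
  move=> Kv; apply: contrapT => Hv; apply: Hno; exists v => // v' Kv'.
  by rewrite leNgt; apply/negP => fv; apply: Hv; exists v'.
have [w Kw|l Dl Hl] := @compact_finite_cover T R K [set f v | v in K]
    (fun b v => f v < b) cK.
  have [v' Kv' fv'] := Hno' w Kw.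
  by exists (f v'); [exists v'|exact: usc].
have [v Kv Hv] : exists2 v, K v & forall b, b \in l -> b <= f v.
  elim: l Dl {Hl} => [|b l IH] Dl; first by exists v0.
  have [|v Kv Hv] := IH; first by move=> i il; apply: Dl; rewrite inE il orbT.
  have [u Ku ub] := Dl b (mem_head _ _).
  have [le|/ltW le] := leP (f v) (f u).
    exists u => // i; rewrite inE => /orP[/eqP ->|/Hv]; first by rewrite ub.
    by move=> /le_trans; apply.
  exists v => // i; rewrite inE => /orP[/eqP ->|/Hv//]; by rewrite -ub.
have [b /Hv bv] := Hl v Kv.
by rewrite ltNge bv.
Qed.

End Compactness.

(** * Inner product of row vectors *)

Section DotProduct.
Variables (R : realType) (n : nat).
Notation V := 'rV[R]_n.
Implicit Types (u v w : V).

Definition dot u v : R := (u *m v^T) 0 0.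

Lemma dotE u v : dot u v = \sum_i u 0 i * v 0 i.
Proof. by rewrite /dot mxE; apply: eq_bigr => i _; rewrite mxE. Qed.
Lemma dotC u v : dot u v = dot v u.
Proof. by rewrite !dotE; apply: eq_bigr => i _; rewrite mulrC. Qed.
Lemma dotDl u v w : dot (u + v) w = dot u w + dot v w.
Proof. by rewrite /dot mulmxDl mxE. Qed.
Lemma dotZl k u w : dot (k *: u) w = k * dot u w.
Proof. by rewrite /dot -scalemxAl mxE. Qed.
Lemma dotNl u w : dot (- u) w = - dot u w.
Proof. by rewrite -scaleN1r dotZl mulN1r. Qed.
Lemma dotDr u v w : dot w (u + v) = dot w u + dot w v.
Proof. by rewrite dotC dotDl !(dotC w). Qed.
Lemma dotZr k u w : dot w (k *: u) = k * dot w u.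
Proof. by rewrite dotC dotZl dotC. Qed.
Lemma dotNr u w : dot w (- u) = - dot w u.
Proof. by rewrite dotC dotNl dotC. Qed.
Lemma dot0l u : dot 0 u = 0.
Proof. by rewrite /dot mul0mx mxE. Qed.
Lemma dot0r u : dot u 0 = 0.
Proof. by rewrite dotC dot0l. Qed.
Definition dot_lin := (dotDl, dotDr, dotNl, dotNr, dotZl, dotZr, dot0l, dot0r).

Lemma dotMl (A : 'M[R]_n) u v : dot (u *m A) v = dot u (v *m A^T).
Proof. by rewrite /dot trmx_mul trmxK mulmxA. Qed.

Lemma dot_ge0 u : 0 <= dot u u.
Proof. by rewrite dotE sumr_ge0// => i _; rewrite -expr2 sqr_ge0. Qed.

Lemma dot_gt0 u : u != 0 -> 0 < dot u u.
Proof.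
move=> u0; rewrite lt_def dot_ge0 andbT; apply: contra u0.
rewrite dotE psumr_eq0; last by move=> i _; rewrite -expr2 sqr_ge0.
move=> /allP u0; apply/eqP/rowP => i; rewrite mxE.
by have /implyP/(_ isT) := u0 i (mem_index_enum _); rewrite mulf_eq0 orbb => /eqP.
Qed.

Lemma cvg_dot (T : Type) (F : set_system T) {FF : Filter F} (f g : T -> V) u v :
  f @ F --> u -> g @ F --> v -> dot (f x) (g x) @[x --> F] --> dot u v.
Proof.
move=> fu gv; rewrite dotE.
under eq_fun do rewrite dotE.
apply: cvg_big => [|i _]; first exact: add_continuous.
apply: cvgM.
  exact: (continuous_cvg _ (@coord_continuous _ _ _ 0 i u) fu).
exact: (continuous_cvg _ (@coord_continuous _ _ _ 0 i v) gv).
Qed.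

End DotProduct.

Section ConvexSets.
Variables (R : realType) (n : nat).
Notation V := 'rV[R]_n.
Implicit Types (A C P : set V) (u v w : V).

Definition cvx A := forall a b (t : R), A a -> A b -> 0 <= t <= 1 ->
  A (t *: a + (1 - t) *: b).

Lemma convex_set_cvx A : convex_set (A : set (convex_lmodType V)) -> cvx A.
Proof.
move=> cA a b t Aa Ab /andP[t0 t1].
have t01 : t \in `[0, 1] by rewrite in_itv/= t0 t1.
have := cA a b (Itv01 t0 t1) (mem_set Aa) (mem_set Ab).
by move/set_mem.
Qed.

Lemma cvx_image_affine A (M : 'M[R]_n) v :
  cvx A -> cvx [set (a - v) *m M | a in A].
Proof.
move=> cA _ _ t [a Aa <-] [b Ab <-] t01; exists (t *: a + (1 - t) *: b).
  exact: cA.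
rewrite !mulmxBl mulmxDl -!scalemxAl !scalerBr addrACA; congr (_ + _).
by rewrite -opprD -scalerDl addrC subrK scale1r.
Qed.

(* A compact stand-in for the convex hull of a finite family. *)
Lemma finite_hull (l : seq V) : l != [::] -> exists C,
  [/\ compact C, cvx C, (forall v, v \in l -> C v) &
     forall A, cvx A -> (forall v, v \in l -> A v) -> C `<=` A].
Proof.
elim: l => // v [|v' l] IH _.
  exists [set v]; split.
  - exact: compact_set1.
  - by move=> a b t -> -> _; rewrite /= -scalerDl addrC subrK scale1r.
  - by move=> w; rewrite inE => /eqP.
  - by move=> A _ Hl w ->; apply: Hl; rewrite inE.
have [C [cC vC lC subC]] := IH isT.
(* The join of [v] with the previous hull, written as a continuous image of [[0, 1]] times [C]. *)
exists [set (p.1 *: v + (1 - p.1) *: p.2 : V) | p in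
          `[0, 1]%classic `*` C]; split.
- apply: continuous_compact; last first.
    by apply: compact_setX => //; exact: segment_compact.
  apply: continuous_subspaceT => p; apply: cvgD.
    by apply: cvgZr_tmp; exact: cvg_fst.
  apply: cvgZ; last exact: cvg_snd.
  by apply: cvgB; [exact: cvg_cst|exact: cvg_fst].
- move=> _ _ t [[s u] [/= + Cu] <-] [[s' u'] [/= + Cu'] <-] /andP[t0 t1] /=.
  rewrite !in_itv/= => /andP[s0 s1] /andP[s0' s1'].
  pose a := t * (1 - s); pose b := (1 - t) * (1 - s').
  have a0 : 0 <= a by rewrite mulr_ge0// subr_ge0.
  have b0 : 0 <= b by rewrite mulr_ge0// subr_ge0.
  (* [a] and [b] are the weights falling on [u] and [u']. If both vanish, the combination is [v]
     itself and the normalised weight [a / (a + b)] makes no sense. *)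
  have [ab0|ab0] := eqVneq (a + b) 0.
    exists (1, u); first by rewrite /= in_itv/= ler01 lexx.
    have /andP[/eqP a00 /eqP b00] : (a == 0) && (b == 0).
      by rewrite -paddr_eq0// ab0.
    rewrite /= subrr scale0r addr0 scale1r !scalerDr !scalerA.
    rewrite -/a -/b a00 b00 !scale0r !addr0 -scalerDl.
    have -> : t * s + (1 - t) * s' = 1 - (a + b) by rewrite /a /b; ring.
    by rewrite a00 b00 addr0 subr0 scale1r.
  have abp : 0 < a + b by rewrite lt_def ab0 addr_ge0.
  exists (1 - (a + b), (a / (a + b)) *: u + (1 - a / (a + b)) *: u').
    split => /=; first by rewrite in_itv/= /a /b; apply/andP; split; nra.
    apply: vC => //; rewrite divr_ge0 ?(ltW abp)//= ler_pdivrMr// mul1r.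
    by rewrite lerDl.
  rewrite /= subKr !scalerDr !scalerA.
  have -> : (a + b) * (a / (a + b)) = a by field.
  have -> : (a + b) * (1 - a / (a + b)) = b by field.
  rewrite -/a -/b [RHS]addrACA -scalerDl; congr (_ *: _ + _).
  by rewrite /a /b; ring.
- have [w0 Cw0] : C !=set0 by exists v'; apply: lC; rewrite mem_head.
  move=> w; rewrite inE => /orP[/eqP ->|wl].
    exists (1, w0); first by rewrite /= in_itv/= ler01 lexx.
    by rewrite /= subrr scale0r addr0 scale1r.
  exists (0, w); first by rewrite /= in_itv/= ler01 lexx; split => //; exact: lC.
  by rewrite /= subr0 scale0r add0r scale1r.
- move=> A cA HA _ [[s u] [/= + Cu] <-]; rewrite in_itv/= => s01.
  apply: (cA) => //; first by apply: HA; rewrite mem_head.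
  by apply: (subC A cA) Cu => w wl; apply: HA; rewrite inE wl orbT.
Qed.

End ConvexSets.

Section Minimax.
Variables (R : realType) (n : nat).
Notation V := 'rV[R]_n.
Implicit Types (A C P : set V) (u v w : V).

(* Bilinear minimax on compact convex sets, through the strictly convex
   regularisation [dot pi v + dot pi pi / 2], whose minimiser over [P] is
   Lipschitz in [v]. *)
Lemma minimax_alternative P C : compact P -> cvx P -> P 0 ->
    compact C -> cvx C -> C !=set0 ->
  (exists2 p, P p & forall v, C v -> dot p v < 0) \/
  (exists2 v, C v & forall p, P p -> 0 <= dot p v).
Proof.
move=> cP vP P0 cC vC C0.
pose J v p := dot p v + dot p p / 2.
have cJ T (F : set_system T) (FF : Filter F) (f g : T -> V) v p :
    f @ F --> v -> g @ F --> p -> J (f x) (g x) @[x --> F] --> J v p.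
  move=> fv gp; apply: cvgD; first exact: cvg_dot.
  by apply: cvgM; [exact: cvg_dot|exact: cvg_cst].
have /choice [pi Hpi] : forall v, exists p, P p /\ forall p', P p' -> J v p <= J v p'.
  move=> v; have [|p b Pp pb|p Pp Hp] := @usc_compact_max R V P (fun p => - J v p) cP.
  - by exists 0.
  - near=> p' => _; near: p'.
    apply: (@cvgr_lt _ _ (nbhs p) _ _ (- J v p)) pb; apply: cvgN.
    exact: (cJ _ (nbhs p) _ (cst v) id v p (cvg_cst _) (@cvg_id _ (nbhs p))).
  - by exists p; split => // p' Pp'; rewrite -lerN2 Hp.
have Ppi v : P (pi v) by case: (Hpi v).
have piM v p : P p -> J v (pi v) <= J v p by case: (Hpi v) => _; exact.
(* Variational inequality for the minimiser [pi v]: towards [p] the increment of [J v] is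
   [s * d + s ^+ 2 * q / 2]. If [d < 0], it is negative for the [s] below, which satisfies
   [s * q <= - d]. *)
have piV v p : P p -> 0 <= dot (v + pi v) (p - pi v).
  move=> Pp; rewrite leNgt; apply/negP => neg.
  set d := dot _ _ in neg.
  pose q := dot (p - pi v) (p - pi v).
  have q0 : 0 <= q by exact: dot_ge0.
  have key s : 0 <= s <= 1 -> 0 <= s * d + s ^+ 2 * q / 2.
    move=> s01; have := piM v _ (vP _ _ _ Pp (Ppi v) s01).
    rewrite -subr_ge0; congr (_ <= _).
    rewrite /J /d /q !dot_lin !(dotC (pi v) v) !(dotC (pi v) p) !(dotC p v).
    by rewrite ?(dotC v p) ?(dotC v (pi v)); field.
  pose s := - d / (q + - d).
  have den : 0 < q + - d by lra.
  have s01 : 0 <= s <= 1.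
    rewrite divr_ge0 ?(ltW den)//=; last lra.
    by rewrite ler_pdivrMr//; lra.
  have s0 : 0 < s by rewrite divr_gt0//; lra.
  have := key s s01.
  have -> : s * d + s ^+ 2 * q / 2 = s * (d + s * q / 2) by ring.
  rewrite pmulr_rge0//.
  have sq : s * q <= - d.
    rewrite /s -mulrA ler_piMr//; first lra.
    by rewrite mulrC ler_pdivrMr//; lra.
  lra.
pose a v := J v (pi v).
have [|v b Cv vb|v Cv Hv] := @usc_compact_max R V C a cC.
- by [].
- near=> v' => _; apply: le_lt_trans (piM v' _ (Ppi v)) _.
  near: v'; apply: (@cvgr_lt _ _ (nbhs v) _ _ (J v (pi v))) vb.
  exact: (cJ _ (nbhs v) _ id (cst (pi v)) v (pi v) (@cvg_id _ (nbhs v)) (cvg_cst _)).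
(* First-order condition at the maximiser [v] of the value function [a]. The variational
   inequalities at [v] and [vs] give [dot d d <= s * dot d w], hence [dot d w <= s * q]; maximality
   gives [dot (pi vs) w <= 0]. So [e <= s * q] for every admissible [s]. *)
have opt u : C u -> dot (pi v) (u - v) <= 0.
  move=> Cu; rewrite leNgt; apply/negP => pos.
  have [w wE] : {w | w = u - v} by exists (u - v).
  move: pos; rewrite -wE; set e := dot _ _ => pos.
  have [q qE] : {q | q = dot w w} by exists (dot w w).
  have q0 : 0 <= q by rewrite qE dot_ge0.
  have key s : 0 < s <= 1 -> e <= s * q.
    move=> /andP[s0 s1].
    have [vs vsE] : {vs | vs = v + s *: w} by exists (v + s *: w).
    have Cvs : C vs.
      have -> : vs = s *: u + (1 - s) *: v.
        by rewrite vsE wE scalerBl scale1r scalerBr addrCA addrA.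
      by apply: vC => //; rewrite ltW.
    have [d dE] : {d | d = pi v - pi vs} by exists (pi v - pi vs).
    have E2 : pi vs = pi v - d by rewrite dE opprB addrC subrK.
    have i1 := piV vs _ (Ppi v); have i2 := piV v _ (Ppi vs).
    have i3 : dot d d <= s * dot d w.
      move: i1 i2; rewrite -[pi vs - pi v]opprB -dE E2 {1}vsE.
      rewrite !dot_lin (dotC w d) => i1 i2.
      by lra.
    have i4 : dot (pi vs) w <= 0.
      have := piM v _ (Ppi vs); have := Hv _ Cvs.
      rewrite /a /J {2}vsE !dot_lin => h1 h2.
      have : s * dot (pi vs) w <= 0 by lra.
      by rewrite pmulr_rle0.
    have i5 : 0 <= dot (d - s *: w) (d - s *: w) by exact: dot_ge0.
    move: i5; rewrite !dot_lin (dotC w d) -qE => i5.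
    have : s * dot d w <= s * (s * q) by lra.
    rewrite ler_pM2l// /e => i6.
    have -> : pi v = d + pi vs by rewrite dE subrK.
    by rewrite dotDl; lra.
  pose s := e / (2 * (q + e)).
  have den : 0 < 2 * (q + e) by lra.
  have s01 : 0 < s <= 1.
    rewrite divr_gt0//=; by rewrite ler_pdivrMr//; lra.
  have := key s s01; apply/negP; rewrite -ltNge.
  have sE : s * (2 * (q + e)) = e by rewrite divfK// gt_eqF.
  have /andP[s0 _] := s01; have se : 0 < s * e by rewrite mulr_gt0.
  by rewrite mulrCA mulrDr in sE; lra.
have a0 : a v <= 0 by have := piM v _ P0; rewrite /J !dot_lin mul0r addr0.
(* A negative value makes [pi v] negative on all of [C]. Value zero makes [v] nonnegative on [P]:
   otherwise some [s *: p], which lies in [P] because [0] does, would make [J v] negative. *)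
have [alt|age] := ltP (a v) 0.
  left; exists (pi v) => // u Cu.
  have := opt u Cu; rewrite !dot_lin.
  by have := dot_ge0 (pi v); move: alt; rewrite /a /J; lra.
right; exists v => // p Pp; rewrite leNgt; apply/negP => neg.
set d := dot _ _ in neg.
pose q := dot p p; have q0 : 0 <= q by exact: dot_ge0.
pose s := - d / (q + - d).
have den : 0 < q + - d by lra.
have s01 : 0 <= s <= 1.
  rewrite divr_ge0 ?(ltW den)//=; last lra.
  by rewrite ler_pdivrMr//; lra.
have s0 : 0 < s by rewrite divr_gt0//; lra.
have := piM v _ (vP _ _ _ Pp P0 s01); rewrite -/(a v) /J !dot_lin -/d -/q.
have sq : s * q <= - d.
  rewrite /s -mulrA ler_piMr//; first lra.
  by rewrite mulrC ler_pdivrMr//; lra.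
have : s * (d + s * q / 2) < 0 by rewrite pmulr_rlt0//; lra.
by lra.
Unshelve. all: by end_near. Qed.

End Minimax.

(** * Expansions along inverse images of segments *)

Section MatrixNorm.
Variable R : realType.

Lemma coord_le_norm m n (A : 'M[R]_(m, n)) i j : `|A i j| <= `|A|.
Proof.
by rewrite [leRHS]/Num.norm /= mx_normrE; apply/bigmax_geP; right => /=; exists (i, j).
Qed.

Lemma norm_le_coord m n (A : 'M[R]_(m, n)) e : 0 <= e ->
  (forall i j, `|A i j| <= e) -> `|A| <= e.
Proof.
by move=> e0 Ae; rewrite [leLHS]/Num.norm /= mx_normrE; apply/bigmax_leP; split.
Qed.

(** The norm is the largest entry in absolute value, whence the factor [n]. *)
Lemma mulmx_norm_le n m (u : 'rV[R]_n) (B : 'M[R]_(n, m)) :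
  `|u *m B| <= n%:R * `|B| * `|u|.
Proof.
apply: norm_le_coord => [|i j]; first by rewrite !mulr_ge0.
rewrite mxE; apply: le_trans (ler_norm_sum _ _ _) _.
apply: (@le_trans _ _ (\sum_(k < n) `|B| * `|u|)).
  apply: ler_sum => k _; rewrite normrM mulrC.
  by apply: ler_pM => //; exact: coord_le_norm.
by rewrite sumr_const card_ord -mulrA mulr_natl.
Qed.

Lemma dot_norm_le n (u v : 'rV[R]_n) : `|dot u v| <= n%:R * `|v^T| * `|u|.
Proof. by apply: le_trans (mulmx_norm_le _ _); exact: coord_le_norm. Qed.

Lemma pos_seq_min (l : seq R) : (forall i, i \in l -> 0 < i) ->
  exists2 d, 0 < d & forall i, i \in l -> d <= i.
Proof.
elim: l => [|a l IH] Hl; first by exists 1.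
have [i il|d d0 Hd] := IH; first by apply: Hl; rewrite inE il orbT.
exists (Num.min a d); first by rewrite lt_min d0 Hl// mem_head.
move=> i; rewrite inE => /orP[/eqP ->|/Hd di]; first by rewrite ge_min lexx.
by rewrite ge_min di orbT.
Qed.

Lemma near_norm_lt (W : normedModType R) (x : W) (r : R) : 0 < r ->
  \forall z \near x, `|z - x| < r.
Proof.
move=> r0; have := @near_ball _ _ x r r0; apply: filterS => z.
by rewrite -ball_normE /= distrC.
Qed.

Lemma near_normP n (x : 'rV[R]_n) (P : set 'rV[R]_n) :
  (\forall z \near x, P z) <-> exists2 r, 0 < r & forall z, `|z - x| < r -> P z.
Proof.
split=> [/nbhs_ballP[r /= r0 Hr]|[r r0 Hr]].
  by exists r => // z zr; apply: Hr; rewrite -ball_normE /= distrC.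
by have := @near_norm_lt 'rV[R]_n x r r0; apply: filterS.
Qed.

Lemma continuous_eps n (W : normedModType R) (f : 'rV[R]_n -> W) x e :
  {for x, continuous f} -> 0 < e ->
  exists2 r, 0 < r & forall z, `|z - x| < r -> `|f z - f x| < e.
Proof.
move=> fx e0; apply/near_normP.
near=> z; rewrite distrC; near: z.
exact: (@cvgr_dist_lt _ _ _ (nbhs x) _ f (f x) fx _ e0).
Unshelve. all: by end_near. Qed.

End MatrixNorm.

Section InverseExpansion.
Variables (R : realType) (n : nat).
Notation V := 'rV[R]_n.

Lemma diff_near (W : normedModType R) (f : V -> W) (x : V) (e : R) :
  differentiable f x -> 0 < e ->
  \forall z \near x, `|f z - f x - 'd f x (z - x)| <= e * `|z - x|.
Proof.
move=> /diff_locally /eqaddoP /(_ e) fx e0; have /near_normP[r r0 Hr] := fx e0.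
apply/near_normP; exists r => // z zr.
have := Hr (z - x); rewrite subr0 => /(_ zr) /=.
by rewrite !fctE/= /shift subrK opprD addrA.
Qed.

Lemma diff_dot (f : V -> R) (x k : V) :
  'd f x k = dot k (\row_i 'd f x (delta_mx 0 i)).
Proof.
rewrite {1}[k]row_sum_delta linear_sum dotE; apply: eq_bigr => i _.
by rewrite linearZ mxE.
Qed.

Lemma diff_mulmx (f : V -> V) (x k : V) :
  'd f x k = k *m \matrix_(i, j) ('d f x (delta_mx 0 i) 0 j).
Proof.
apply/rowP => j; rewrite {1}[k]row_sum_delta linear_sum summxE mxE.
by apply: eq_bigr => i _; rewrite linearZ !mxE.
Qed.

Variables (Z : set V) (g : V -> V).
Hypotheses (cZ : compact Z) (cg : forall z, Z z -> {for z, continuous g}).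
Hypothesis (ig : forall z1 z2, Z z1 -> Z z2 -> g z1 = g z2 -> z1 = z2).

(** A continuous injection on a compact set has a continuous inverse. Finitely many [P i] cover [Z],
    and the least such [i] serves as [d]. *)
Lemma inverse_continuous z0 r : Z z0 -> 0 < r ->
  exists2 d, 0 < d & forall z, Z z -> `|g z - g z0| < d -> `|z - z0| < r.
Proof.
move=> Zz0 r0.
pose P (i : R) (z : V) := `|z - z0| < r \/ i <= `|g z - g z0|.
have [w Zw|l Dl Hl] := @compact_finite_cover _ _ Z [set i | 0 < i] P cZ.
  have [wr|wr] := ltP `|w - z0| r.
    exists 1; first exact: ltr01.
    have d0 : 0 < r - `|w - z0| by rewrite subr_gt0.
    have := @near_norm_lt R V w _ d0; apply: filterS => z zw _; left.
    have -> : z - z0 = (z - w) + (w - z0) by rewrite addrA subrK.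
    by apply: le_lt_trans (ler_normD _ _) _; rewrite -ltrBrDr.
  have gw : 0 < `|g w - g z0|.
    rewrite normr_gt0 subr_eq0; apply/eqP => /(ig Zw Zz0) wz.
    by move: wr; rewrite wz subrr normr0 leNgt r0.
  exists (`|g w - g z0| / 2); first by rewrite /= divr_gt0.
  have g2 : 0 < `|g w - g z0| / 2 by rewrite divr_gt0.
  have [r' r'0 Hr'] := continuous_eps (cg Zw) g2.
  apply/near_normP; exists r' => // z /Hr'; rewrite distrC => zw _; right.
  have : `|g w - g z0| <= `|g w - g z| + `|g z - g z0|.
    by have := ler_normD (g w - g z) (g z - g z0); rewrite addrA subrK.
  lra.
have [d d0 Hd] := pos_seq_min Dl.
exists d => // z Zz zd; have [i /Hd di [//|iz]] := Hl z Zz.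
by have := lt_le_trans zd (le_trans di iz); rewrite ltxx.
Qed.

(** First-order expansion of [F] in the coordinate [g], with derivative ['d F z0] after [invmx A].
    It is relative to [Z], so [z0] may be a boundary point. *)
Lemma inverse_expansion (F : V -> R) z0 (A : 'M[R]_n) e : Z z0 ->
  differentiable g z0 -> (forall k, 'd g z0 k = k *m A) -> A \in unitmx ->
  differentiable F z0 -> 0 < e ->
  exists2 d, 0 < d & forall z, Z z -> `|g z - g z0| < d ->
    `|F z - F z0 - 'd F z0 ((g z - g z0) *m invmx A)| <= e * `|g z - g z0|.
Proof.
move=> Zz0 dg gA uA dF e0.
pose B := invmx A.
pose Cb : R := n%:R * `|B| + 1.
pose Cf : R := n%:R * `|(\row_i 'd F z0 (delta_mx 0 i))^T| + 1.
have Cb0 : 0 < Cb by rewrite ltr_wpDl// mulr_ge0.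
have Cf0 : 0 < Cf by rewrite ltr_wpDl// mulr_ge0.
have HB (u : V) : `|u *m B| <= Cb * `|u|.
  apply: le_trans (mulmx_norm_le _ _) _.
  by rewrite ler_wpM2r// lerDl.
have HF (u : V) : `|'d F z0 u| <= Cf * `|u|.
  rewrite diff_dot; apply: le_trans (dot_norm_le _ _) _.
  by rewrite ler_wpM2r// lerDl.
(* The first bound on [e1] yields [H4], where the displacement [k] is controlled by [D]; the second
   makes the error of [g] cost at most half of [e]. The error of [F], through [e2], takes the other
   half. *)
pose e1 := Num.min (1 / (2 * Cb)) (e / (4 * Cf * Cb * Cb)).
have e10 : 0 < e1 by rewrite lt_min !divr_gt0// !mulr_gt0.
have e1a : Cb * e1 <= 1 / 2.
  have : e1 <= 1 / (2 * Cb) by rewrite ge_min lexx.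
  by rewrite ler_pdivlMr ?mulr_gt0//; lra.
have e1b : 4 * Cf * Cb * Cb * e1 <= e.
  have : e1 <= e / (4 * Cf * Cb * Cb) by rewrite ge_min lexx orbT.
  by rewrite ler_pdivlMr ?mulr_gt0// mulrC.
pose e2 := e / (4 * Cb).
have e20 : 0 < e2 by rewrite divr_gt0// mulr_gt0.
have e2a : 4 * Cb * e2 = e by rewrite /e2 mulrC divfK// gt_eqF// mulr_gt0.
have /near_normP[r1 r10 H1] := diff_near dg e10.
have /near_normP[r2 r20 H2] := diff_near dF e20.
have [d d0 Hd] := @inverse_continuous z0 (Num.min r1 r2) Zz0 ltac:(by rewrite lt_min r10).
exists d => // z Zz zd.
have := Hd z Zz zd; rewrite lt_min => /andP[/H1 {}H1 /H2 {}H2].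
set k := z - z0 in H1 H2; set D := g z - g z0 in H1 *.
have H3 : `|D *m B - k| <= Cb * e1 * `|k|.
  have -> : D *m B - k = (D - 'd g z0 k) *m B.
    by rewrite gA [RHS]mulmxBl /B mulmxK.
  by apply: le_trans (HB _) _; rewrite -mulrA ler_pM2l.
have H4 : `|k| <= 2 * Cb * `|D|.
  have h : `|k| <= `|D *m B| + `|D *m B - k|.
    by rewrite -{1}[k](subKr (D *m B)); exact: ler_normB.
  have hh : Cb * e1 * `|k| <= 1 / 2 * `|k| by rewrite ler_wpM2r.
  by have := HB D; lra.
have -> : F z - F z0 - 'd F z0 (D *m B) =
    (F z - F z0 - 'd F z0 k) - 'd F z0 (D *m B - k).
  have -> : 'd F z0 (D *m B - k) = 'd F z0 (D *m B) - 'd F z0 k by exact: linearB.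
  by ring.
apply: le_trans (ler_normB _ _) _.
have H5 : `|'d F z0 (D *m B - k)| <= Cf * (Cb * e1 * `|k|).
  by apply: le_trans (HF _) _; rewrite ler_pM2l.
apply: (@le_trans _ _ ((e2 + Cf * Cb * e1) * `|k|)); first by lra.
apply: (@le_trans _ _ ((e2 + Cf * Cb * e1) * (2 * Cb * `|D|))).
  by rewrite ler_wpM2l// addr_ge0 ?ltW// !mulr_gt0.
rewrite mulrA ler_wpM2r//; lra.
Qed.

(** [e] keeps the error in [inverse_expansion] below the linear term, which therefore decides the
    sign of the increment. *)
Lemma directional_sign (F : V -> R) z0 (A : 'M[R]_n) u : Z z0 ->
  differentiable g z0 -> (forall k, 'd g z0 k = k *m A) -> A \in unitmx ->
  differentiable F z0 -> 'd F z0 (u *m invmx A) != 0 ->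
  exists2 d, 0 < d & forall s z, 0 < s < d -> Z z -> g z = g z0 + s *: u ->
    0 < (F z - F z0) * 'd F z0 (u *m invmx A).
Proof.
move=> Zz0 dg gA uA dF; set D := 'd F z0 _ => D0.
have aD : 0 < `|D| by rewrite normr_gt0.
have u1 : 0 < `|u| + 1 by rewrite ltr_wpDl.
pose e := `|D| / (2 * (`|u| + 1)).
have e0 : 0 < e by rewrite divr_gt0// mulr_gt0.
have [d d0 Hd] := inverse_expansion Zz0 dg gA uA dF e0.
exists (d / (`|u| + 1)); first by rewrite divr_gt0.
move=> s z /andP[s0 sd] Zz gz.
have gz' : g z - g z0 = s *: u by rewrite gz addrC addKr.
have := Hd z Zz; rewrite gz' normrZ gtr0_norm// => Hz.
have su : s * `|u| < d.
  by move: sd; rewrite ltr_pdivlMr// => /(le_lt_trans _); apply; rewrite ler_pM2l// lerDl.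
have {Hz} := Hz su; rewrite -scalemxAl linearZ /= -/D => Hz.
have eu : e * (s * `|u|) < s * `|D|.
  rewrite mulrCA ltr_pM2l// /e mulrAC ltr_pdivrMr ?mulr_gt0// ltr_pM2l//.
  by have := normr_ge0 u; lra.
have {Hz eu} := le_lt_trans Hz eu.
move: (F z - F z0) => f Hf.
have sD : 0 < s * `|D| by rewrite mulr_gt0.
have [Dp|Dn] := ltP 0 D.
  move: Hf; rewrite (gtr0_norm Dp) ltr_norml => /andP[h _].
  by rewrite pmulr_lgt0//; have : s *: D = s * D by []; lra.
have Dn' : D < 0 by rewrite lt_def eq_sym D0.
move: Hf; rewrite (ltr0_norm Dn') ltr_norml => /andP[_ h].
by rewrite nmulr_lgt0//; have : s *: D = s * D by []; lra.
Qed.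

End InverseExpansion.

Section Curves.
Variables (R : realType) (n : nat).
Notation V := 'rV[R]_n.
Variables (Z : set V) (g : V -> V) (A : V -> 'M[R]_n).
Hypotheses (cZ : compact Z)
  (ig : forall z1 z2, Z z1 -> Z z2 -> g z1 = g z2 -> z1 = z2)
  (dg : forall z, Z z -> differentiable g z)
  (gA : forall z k, Z z -> 'd g z k = k *m A z)
  (uA : forall z, Z z -> A z \in unitmx).
Variables (F : V -> R) (gam : R -> V) (u v : V).
Hypotheses (dF : forall z, Z z -> differentiable F z)
  (Zgam : forall t, 0 <= t <= 1 -> Z (gam t))
  (ggam : forall t, 0 <= t <= 1 -> g (gam t) = v + t *: u).

Let slope t := 'd F (gam t) (u *m invmx (A (gam t))).

(** [gam] is only known through its image, a straight segment. The regularity of [F] along it comes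
    from [inverse_expansion], the image moving by [(s - t) *: u]. *)
Lemma curve_expansion t e : 0 <= t <= 1 -> 0 < e ->
  exists2 d, 0 < d & forall s, 0 <= s <= 1 -> `|s - t| < d ->
    `|F (gam s) - F (gam t) - (s - t) * slope t| <= e * `|s - t|.
Proof.
move=> t01 e0; have Zt := Zgam t01.
have u1 : 0 < `|u| + 1 by rewrite ltr_wpDl.
have e'0 : 0 < e / (`|u| + 1) by rewrite divr_gt0.
have cg z : Z z -> {for z, continuous g}.
  by move=> /dg; exact: differentiable_continuous.
have [d d0 Hd] := inverse_expansion cZ cg ig Zt (dg Zt) (fun k => gA k Zt)
  (uA Zt) (dF Zt) e'0.
exists (d / (`|u| + 1)); first by rewrite divr_gt0.
move=> s s01; rewrite ltr_pdivlMr// => sd.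
have gs : g (gam s) - g (gam t) = (s - t) *: u.
  by rewrite !ggam// scalerBl opprD addrACA subrr add0r.
have := Hd _ (Zgam s01); rewrite gs normrZ -scalemxAl linearZ => Hs.
apply: le_trans (Hs _) _.
  by apply: le_lt_trans sd; rewrite ler_wpM2l// lerDl.
rewrite mulrAC ler_pdivrMr// -mulrA ler_pM2l// ler_wpM2l// lerDl//.
Qed.

Lemma curve_continuous : {within `[0, 1], continuous (F \o gam)}.
Proof.
apply/subspace_continuousP => t /=; rewrite in_itv/= => t01.
apply/cvgrPdist_lt => e e0.
have [d d0 Hd] := curve_expansion t01 ltr01.
have D1 : 0 < 1 + `|slope t| by rewrite ltr_pwDl.
have r0 : 0 < Num.min d (e / (1 + `|slope t|)) by rewrite lt_min d0 divr_gt0.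
rewrite near_withinE; near=> s; rewrite /= in_itv/= => s01.
have : `|s - t| < Num.min d (e / (1 + `|slope t|)).
  by near: s; exact: (@near_norm_lt _ R^o).
rewrite lt_min => /andP[/(Hd _ s01) H1].
rewrite ltr_pdivlMr// => H2; rewrite distrC.
have := ler_normD (F (gam s) - F (gam t) - (s - t) * slope t)
   ((s - t) * slope t).
by rewrite subrK normrM; lra.
Unshelve. all: by end_near. Qed.

Lemma curve_derive (t : R) : t \in `]0, 1[ -> is_derive t 1 (F \o gam) (slope t).
Proof.
rewrite in_itv/= => /andP[t0 t1].
have t01 : 0 <= t <= 1 by rewrite !ltW.
suff h : (fun h => h^-1 *: (((F \o gam) \o shift t) (h *: 1) - (F \o gam) t))
    @ (0 : R)^' --> slope t.
  by apply: DeriveDef; [apply/cvg_ex; exists (slope t)|exact/cvg_lim].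
apply/cvgrPdist_le => e e0.
have [d d0 Hd] := curve_expansion t01 e0.
have r0 : 0 < Num.min d (Num.min t (1 - t)) by rewrite !lt_min d0 t0 subr_gt0.
near=> h.
have h0 : h != 0 by near: h; exact: nbhs_dnbhs_neq.
have : `|h| < Num.min d (Num.min t (1 - t)).
  by rewrite -[h]subr0; near: h; apply: nbhs_dnbhs; exact: (@near_norm_lt _ R^o).
rewrite !lt_min !ltr_norml => /and3P[hd ht ht1].
have s01 : 0 <= h + t <= 1 by lra.
have := Hd _ s01; rewrite addrK ltr_norml => /(_ hd).
rewrite /= /shift scaler1 => H1.
have -> : slope t - h^-1 *: (F (gam (h + t)) - F (gam t)) =
    - (h^-1 * (F (gam (h + t)) - F (gam t) - h * slope t)).
  by rewrite /GRing.scale /=; field.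
rewrite normrN normrM normfV ler_pdivrMl ?normr_gt0//.
by rewrite [leRHS]mulrC.
Unshelve. all: by end_near. Qed.

End Curves.

(** Were [f t] above both end values, let [a'] be the last point of [[0, t]] where [f] is at most
    their maximum [m]. The mean value theorem on [[a', t]] gives a point where [f] exceeds [m]; both
    sign conditions apply there, so the derivative is zero and [f t = f a']. *)
Lemma quasiconvex_first_order (R : realType) (f df : R -> R) :
  {within `[0, 1], continuous f} ->
  (forall t : R, t \in `]0, 1[ -> is_derive t 1 f (df t)) ->
  (forall t : R, t \in `]0, 1[ -> f 0 <= f t -> 0 <= df t) ->
  (forall t : R, t \in `]0, 1[ -> f 1 <= f t -> df t <= 0) ->
  forall t, 0 <= t <= 1 -> f t <= Num.max (f 0) (f 1).
Proof.
move=> cf fD f0 f1 t /andP[t0 t1]; rewrite leNgt; apply/negP.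
set m := Num.max _ _ => mt.
have f0m : f 0 <= m by rewrite le_max lexx.
have f1m : f 1 <= m by rewrite le_max lexx orbT.
have {}t1 : t < 1.
  by rewrite lt_neqAle t1 andbT; apply/eqP => te; move: mt; rewrite te ltNge f1m.
(* The maximum of [h] is the last point of the sublevel set in [[0, t]], and [h] is upper
   semicontinuous because that set is closed. The default [0] is harmless since [f 0 <= m]. *)
pose h s := if f s <= m then s else 0.
have sub : `[0, t] `<=` (`[0, 1] : set R).
  by apply: subset_itvl; rewrite bnd_simp ltW.
have [||s b|a] := @usc_compact_max R _ `[0, t]%classic h.
- exact: segment_compact.
- by exists 0; rewrite /= in_itv/= lexx.
- move=> s0t; rewrite /h; case: ifP => fs sb.
    have b0 : 0 < b.
      by move: s0t; rewrite /= in_itv/= => /andP[s0 _]; exact: le_lt_trans s0 sb.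
    near=> s' => _; case: ifP => // _.
    by near: s'; exact: lt_nbhsl.
  move/negbT: fs; rewrite -ltNge => fs.
  have /subspace_continuousP /(_ s (sub _ s0t)) cfs := cf.
  near=> s' => s't.
  have /(_ (sub _ s't)) fs' : `[0, 1]%classic s' -> m < f s'.
    by near: s'; exact: (@cvgr_gt _ _ (within `[0, 1] (nbhs s)) _ f (f s) cfs _ fs).
  by rewrite leNgt fs'.
rewrite /= in_itv/= => /andP[a0 at_] Ha.
have [a' [a'0 a't fa' Ha']] : exists a', [/\ 0 <= a', a' <= t, f a' <= m &
    forall s, 0 <= s <= t -> f s <= m -> s <= a'].
  exists (h a); split.
  - by rewrite /h; case: ifP.
  - by rewrite /h; case: ifP.
  - by rewrite /h; case: ifP.
  - by move=> s s0t fs; have := Ha s; rewrite /= in_itv/= s0t {1}/h fs; exact.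
have {}a't : a' < t.
  by rewrite lt_neqAle a't andbT; apply/eqP => te; move: mt; rewrite -te ltNge fa'.
have in01 x : x \in `]a', t[ -> x \in `]0, 1[.
  by rewrite !in_itv/= => /andP[ax xt]; rewrite (le_lt_trans a'0 ax) (lt_trans xt).
have fD' x : x \in `]a', t[ -> is_derive x 1 f (df x) by move=> /in01; exact: fD.
have cf' : {within `[a', t], continuous f}.
  apply: continuous_subspaceW cf => x /=; rewrite !in_itv/= => /andP[ax xt].
  by rewrite (le_trans a'0 ax) (le_trans xt (ltW t1)).
have [x xat E] := MVT a't fD' cf'.
have mx : m < f x.
  rewrite ltNge; apply/negP => fx; move: (xat); rewrite in_itv/= => /andP[ax xt].
  have := Ha' x; rewrite (ltW xt) (le_trans a'0 (ltW ax)) => /(_ isT fx).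
  by rewrite leNgt ax.
have dx : df x = 0.
  apply/eqP; rewrite eq_le f1 ?f0 ?in01//.
  - by rewrite (le_trans f0m (ltW mx)).
  - by rewrite (le_trans f1m (ltW mx)).
by move: E; rewrite dx mul0r; lra.
Unshelve. all: by end_near. Qed.

(** * The cross difference and Loeper's property *)

Section InnerPoints.
Variables (R : realType) (n : nat).
Notation V := 'rV[R]_n.

(* For convex [P] these are the interior points; this form needs no open
   mapping theorem. *)
Definition inner (P : set V) (p : V) :=
  forall w, w != 0 -> exists2 b, P b & 0 < dot (b - p) w.

(** A test point for [q], mixed with [p] in the same proportion, is a test point for the mixture. *)
Lemma inner_mix (P : set V) p q (s : R) : cvx P -> P p -> P q -> inner P q ->
  0 < s <= 1 -> inner P (s *: q + (1 - s) *: p).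
Proof.
move=> cP Pp Pq Iq /andP[s0 s1] w w0; have [b Pb bq] := Iq w w0.
exists (s *: b + (1 - s) *: p); first by apply: cP => //; rewrite ltW.
rewrite opprD addrACA subrr addr0 -scalerBr dotZl.
by rewrite mulr_gt0.
Qed.

(** The step [h *: k] with [k := w *m A^T] moves the image by about [h *: (k *m A)], whose product
    with [w] is [h * dot k k]; [e] keeps the error within half of that. *)
Lemma inner_image_interior (Z : set V) (g : V -> V) z0 (A : 'M[R]_n) :
  Z° z0 -> differentiable g z0 -> (forall k, 'd g z0 k = k *m A) ->
  A \in unitmx -> inner [set g z | z in Z] (g z0).
Proof.
move=> Zz0 dg gA uA w w0.
pose k := w *m A^T.
have k0 : k != 0.
  apply: contra_neq w0 => kE; rewrite -[w](@mulmxK _ _ _ A^T) ?unitmx_tr//.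
  by rewrite -/k kE mul0mx.
pose C : R := n%:R * `|w^T| + 1.
have C0 : 0 < C by rewrite ltr_wpDl// mulr_ge0.
have nk : 0 < `|k| by rewrite normr_gt0.
have kk := dot_gt0 k0.
pose e := dot k k / (2 * C * `|k|).
have e0 : 0 < e by rewrite divr_gt0// !mulr_gt0.
have /near_normP[r r0 Hr] := diff_near dg e0.
have /near_normP[r' r'0 Hr'] : \forall z \near z0, Z z by exact: Zz0.
pose h := Num.min r r' / (2 * `|k|).
have m0 : 0 < Num.min r r' by rewrite lt_min r0.
have h0 : 0 < h by rewrite divr_gt0// mulr_gt0.
have hk : `|h *: k| < Num.min r r'.
  rewrite normrZ gtr0_norm// /h invfM mulrA mulfVK ?gt_eqF//; lra.
move: hk; rewrite lt_min => /andP[hkr hkr'].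
exists (g (h *: k + z0)).
  by exists (h *: k + z0) => //; apply: Hr'; rewrite addrK.
have := Hr (h *: k + z0); rewrite addrK => /(_ hkr).
rewrite gA -scalemxAl; move: (g _ - g z0) => D HD.
have -> : dot D w = h * dot k k + dot (D - h *: (k *m A)) w.
  by rewrite dotDl dotNl dotZl dotMl -/k; ring.
have := dot_norm_le (D - h *: (k *m A)) w.
move: HD; move: (D - _) => B HD HB.
have {}HB : `|dot B w| <= C * (e * `|h *: k|).
  apply: le_trans HB _; apply: ler_pM => //; by rewrite /C lerDl.
have : C * (e * `|h *: k|) = h * dot k k / 2.
  rewrite normrZ gtr0_norm// /e.
  by field; rewrite !gt_eqF.
have hkk : 0 < h * dot k k by rewrite mulr_gt0.
move: HB; rewrite ler_norml => /andP[HB _] HE; lra.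
Qed.

End InnerPoints.

Section SegmentAlgebra.
Variables (R : pzRingType) (W : lmodType R).
Implicit Types (a b u : W) (t : R).

Lemma opp_segment a b t : - (a + t *: (b - a)) = t *: - b + (1 - t) *: - a.
Proof.
by rewrite scalerBl scale1r scalerBr !scalerN opprD opprB opprK addrA addrC.
Qed.

Lemma sub_segment0 a u t : a - (a + t *: u) = - t *: u.
Proof. by rewrite opprD addrA subrr add0r scaleNr. Qed.

Lemma sub_segment1 a b t : b - (a + t *: (b - a)) = (1 - t) *: (b - a).
Proof. by rewrite opprD addrA scalerBl scale1r. Qed.

End SegmentAlgebra.

Lemma diff_oppD (R : realType) n (f g : 'rV[R]_n -> R) x k :
  differentiable f x -> differentiable g x ->
  'd (fun z => - f z + g z) x k = - 'd f x k + 'd g x k.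
Proof.
move=> df dg; have dNf : differentiable (- f) x by exact: differentiableN.
rewrite (_ : (fun z => - f z + g z) = - f + g)//.
have e1 := congr1 (fun h => h k) (diffD dNf dg).
have e2 := congr1 (fun h => h k) (diffN df).
exact (etrans e1 (congr1 (fun z => z + 'd g x k) e2)).
Qed.

Section Cross.
Variables (R : realType) (n : nat).
Notation V := 'rV[R]_n.

(* [gx], [gy] and [M] stand for [gradx c], [grady c] and [Dxy c]; keeping them
   abstract makes the two variables of the cost interchangeable. *)
Record cost_data (X Y : set V) (c : V -> V -> R) (gx gy : V -> V -> V)
    (M : V -> V -> 'M[R]_n) : Prop := CostData {
  cd_cX : compact X;
  cd_iX : X° !=set0;
  cd_cY : compact Y;
  cd_iY : Y° !=set0;
  cd_dcx : forall x y, X x -> Y y -> differentiable (fun x' => c x' y) x;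
  cd_dcxE : forall x y k, X x -> Y y -> 'd (fun x' => c x' y) x k = dot k (gx x y);
  cd_dcy : forall x y, X x -> Y y -> differentiable (fun y' => c x y') y;
  cd_dcyE : forall x y k, X x -> Y y -> 'd (fun y' => c x y') y k = dot k (gy x y);
  cd_dgy : forall x y, X x -> Y y -> differentiable (fun x' => gy x' y) x;
  cd_dgyE : forall x y k, X x -> Y y -> 'd (fun x' => gy x' y) x k = k *m M x y;
  cd_dgx : forall x y, X x -> Y y -> differentiable (fun y' => gx x y') y;
  cd_dgxE : forall x y k, X x -> Y y -> 'd (fun y' => gx x y') y k = k *m (M x y)^T;
  cd_unit : forall x y, X x -> Y y -> M x y \in unitmx;
  cd_gy_inj : forall y x1 x2, Y y -> X x1 -> X x2 -> gy x1 y = gy x2 y -> x1 = x2;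
  cd_gx_inj : forall x y1 y2, X x -> Y y1 -> Y y2 -> gx x y1 = gx x y2 -> y1 = y2;
  cd_gy_cvx : forall y, Y y -> cvx [set gy x y | x in X];
  cd_gx_cvx : forall x, X x -> cvx [set gx x y | y in Y] }.

Definition swap T (f : V -> V -> T) := fun y x => f x y.

(** Exchanging the variables transposes the mixed derivative. Every fact proved for one variable
    thereby yields its dual. *)
Lemma cost_data_swap X Y c gx gy M : cost_data X Y c gx gy M ->
  cost_data Y X (swap c) (swap gy) (swap gx) (fun y x => (M x y)^T).
Proof.
move=> [cX iX cY iY dcx dcxE dcy dcyE dgy dgyE dgx dgxE uM gyi gxi gyv gxv].
apply: CostData.
- exact: cY.
- exact: iY.
- exact: cX.
- exact: iX.
- by move=> y x Yy Xx; exact: dcy.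
- by move=> y x k Yy Xx; exact: dcyE.
- by move=> y x Yy Xx; exact: dcx.
- by move=> y x k Yy Xx; exact: dcxE.
- by move=> y x Yy Xx; exact: dgx.
- by move=> y x k Yy Xx; exact: dgxE.
- by move=> y x Yy Xx; exact: dgy.
- by move=> y x k Yy Xx; rewrite trmxK; exact: dgyE.
- by move=> y x Yy Xx; rewrite unitmx_tr; exact: uM.
- exact: gxi.
- exact: gyi.
- exact: gxv.
- exact: gyv.
Qed.

Variables (X Y : set V) (c : V -> V -> R) (gx gy : V -> V -> V)
  (M : V -> V -> 'M[R]_n).
Hypothesis H : cost_data X Y c gx gy M.
Implicit Types x y : V.

(** The c-segment as a curve, by choice from the convexity of the image; values outside [[0, 1]] are
    arbitrary. Injectivity identifies the end points. *)
Lemma c_curve x0 x1 y : X x0 -> X x1 -> Y y -> exists gam : R -> V,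
  [/\ forall t, 0 <= t <= 1 -> X (gam t),
      forall t, 0 <= t <= 1 ->
        gy (gam t) y = gy x0 y + t *: (gy x1 y - gy x0 y),
      gam 0 = x0 & gam 1 = x1].
Proof.
move=> X0 X1 Yy.
have /choice[gam Hgam] : forall t : R, exists x, 0 <= t <= 1 -> X x /\
    gy x y = gy x0 y + t *: (gy x1 y - gy x0 y).
  move=> t; have [t01|_] := boolP (0 <= t <= 1); last by exists x0.
  have vX := cd_gy_cvx H Yy.
  have [||x Xx xE] := vX (gy x1 y) (gy x0 y) t _ _ t01.
  - by exists x1.
  - by exists x0.
  exists x => _; split => //; rewrite xE scalerBl scale1r scalerBr.
  by rewrite addrCA.
have h0 : 0 <= (0 : R) <= 1 by rewrite lexx ler01.
have h1 : 0 <= (1 : R) <= 1 by rewrite lexx ler01.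
exists gam; split.
- by move=> t /Hgam[].
- by move=> t /Hgam[].
- have [Xg gE] := Hgam 0 h0; apply: (cd_gy_inj H Yy Xg X0).
  by rewrite gE scale0r addr0.
- have [Xg gE] := Hgam 1 h1; apply: (cd_gy_inj H Yy Xg X1).
  by rewrite gE scale1r addrC subrK.
Qed.

Definition cdiff y y0 x := - c x y + c x y0.

Lemma cdiff_differentiable y y0 x : X x -> Y y -> Y y0 ->
  differentiable (cdiff y y0) x.
Proof.
move=> Xx Yy Y0; apply: differentiableD; last exact: (cd_dcx H).
by apply: differentiableN; exact: (cd_dcx H).
Qed.

Lemma diff_cdiff y y0 x k : X x -> Y y -> Y y0 ->
  'd (cdiff y y0) x k = - dot k (gx x y - gx x y0).
Proof.
move=> Xx Yy Y0; have d1 := cd_dcx H Xx Yy.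
have d0 := cd_dcx H Xx Y0.
rewrite (diff_oppD k d1 d0) (cd_dcxE H k Xx Yy) (cd_dcxE H k Xx Y0) dotDr dotNr.
by rewrite opprB addrC.
Qed.

Definition cross x xb y y0 := - c x y + c x y0 + c xb y - c xb y0.

(* The derivative of [cross x xb y y0] at [x = xb] along the c-segment with
   respect to [y0], and equally at [y = y0] along the c-segment with respect
   to [xb]. *)
Definition slope x xb y y0 :=
  - dot ((gy x y0 - gy xb y0) *m invmx (M xb y0))
        (gx xb y - gx xb y0).

(** On a c-segment with velocity [u], the vector from a point to either end is a multiple of [u];
    this relates [slope] to the derivative along the curve. *)
Lemma slope_scale x xb y y0 k u : gy x y0 - gy xb y0 = k *: u ->
  slope x xb y y0 =
  k * - dot (u *m invmx (M xb y0)) (gx xb y - gx xb y0).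
Proof.
by rewrite /slope => ->; rewrite -scalemxAl dotZl mulrN.
Qed.

(** [cross] vanishes at [xb] and [slope] is its derivative there, so [directional_sign] applies. *)
Lemma cross_sign_x x xb y y0 : X x -> X xb -> Y y -> Y y0 ->
  slope x xb y y0 != 0 ->
  exists2 d, 0 < d & forall s z, 0 < s < d -> X z ->
    gy z y0 = gy xb y0 + s *: (gy x y0 - gy xb y0) ->
    0 < cross z xb y y0 * slope x xb y y0.
Proof.
move=> Xx Xb Yy Y0 S0.
have dF := cdiff_differentiable Xb Yy Y0.
pose u := gy x y0 - gy xb y0.
have E : 'd (cdiff y y0) xb (u *m invmx (M xb y0)) = slope x xb y y0.
  by rewrite diff_cdiff.
have cg z : X z -> {for z, continuous (fun x' => gy x' y0)}.
  by move=> Xz; apply: differentiable_continuous; exact: (cd_dgy H).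
have := @directional_sign R n X (fun x' => gy x' y0) (cd_cX H) cg
  (fun z1 z2 h1 h2 => cd_gy_inj H Y0 h1 h2) (cdiff y y0) xb _ u Xb
  (cd_dgy H Xb Y0) (fun k => cd_dgyE H k Xb Y0) (cd_unit H Xb Y0) dF.
rewrite E => /(_ S0)[d d0 Hd]; exists d => // s z sd Xz zE.
have := Hd s z sd Xz zE; congr (_ < _ * _).
by rewrite /cdiff /cross; ring.
Qed.

End Cross.

Section CrossCondition.
Variables (R : realType) (n : nat).
Notation V := 'rV[R]_n.
Variables (X Y : set V) (c : V -> V -> R) (gx gy : V -> V -> V)
  (M : V -> V -> 'M[R]_n).
Hypothesis H : cost_data X Y c gx gy M.
Implicit Types x y : V.
Let H' := cost_data_swap H.

(** The symmetry behind the duality: the derivative in [y] is the same bilinear expression, with the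
    inverse matrix moved to the other factor. *)
Lemma slope_swap x xb y y0 :
  slope (swap gy) (swap gx) (fun y x => (M x y)^T) y y0 x xb = slope gx gy M x xb y y0.
Proof. by rewrite /slope /swap -trmx_inv dotMl trmxK dotC. Qed.

Lemma cross_swap x xb y y0 : cross (swap c) y y0 x xb = cross c x xb y y0.
Proof. by rewrite /cross /swap; ring. Qed.

Lemma cross_sign_y x xb y y0 : X x -> X xb -> Y y -> Y y0 ->
  slope gx gy M x xb y y0 != 0 ->
  exists2 d, 0 < d & forall s z, 0 < s < d -> Y z ->
    gx xb z = gx xb y0 + s *: (gx xb y - gx xb y0) ->
    0 < cross c x xb z y0 * slope gx gy M x xb y y0.
Proof.
rewrite -slope_swap => Xx Xb Yy Y0 S0.
have [d d0 Hd] := cross_sign_x H' Yy Y0 Xx Xb S0.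
by exists d => // s z sd Yz zE; rewrite -cross_swap; exact: Hd sd Yz zE.
Qed.

Definition cross_condition := forall x xb y y0, X x -> X xb -> Y y -> Y y0 ->
  cross c x xb y y0 <= 0 -> slope gx gy M x xb y y0 <= 0.

Hypothesis gyE : forall x y, gy x y = grady c x y.

(** With a positive slope, [cdiff c y y0] exceeds its value at [xb] just after leaving [xb]. Since
    [cross] is nonpositive at [x], that value is the larger of the two end values, against Loeper's
    property. *)
Lemma Loeper_cross_condition : Loeper X Y c -> cross_condition.
Proof.
move=> L x xb y y0 Xx Xb Yy Y0 cr; rewrite leNgt; apply/negP => S0.
have [|d d0 Hd] := cross_sign_x H Xx Xb Yy Y0; first by rewrite gt_eqF.
have [gam [Xg gE _ _]] := c_curve H Xb Xx Y0.
pose s := Num.min d 1 / 2.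
have m0 : 0 < Num.min d 1 by rewrite lt_min d0 ltr01.
have md : Num.min d 1 <= d by rewrite ge_min lexx.
have m1 : Num.min d 1 <= 1 by rewrite ge_min lexx orbT.
have sd : 0 < s < d by rewrite /s; lra.
have s01 : 0 <= s <= 1 by rewrite /s; lra.
have := Hd s (gam s) sd (Xg _ s01) (gE _ s01); rewrite pmulr_lgt0//.
have : - c (gam s) y + c (gam s) y0 <=
    Num.max (- c xb y + c xb y0) (- c x y + c x y0).
  apply: L => //; split; first exact: Xg.
  by exists s; split; [exact: s01|rewrite -!gyE (gE _ s01); exact: opp_segment].
rewrite max_l; first by rewrite /cross; lra.
by move: cr; rewrite /cross; lra.
Qed.

(** [quasiconvex_first_order] along the c-segment: the condition based at the current point and
    tested on [x0], respectively [x1], gives the two sign requirements on the derivative. *)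
Lemma cross_condition_Loeper : cross_condition -> Loeper X Y c.
Proof.
move=> L x0 x1 y0 y xt X0 X1 Y0 Yy [Xt [t [t01 tE]]].
have [gam [Xg gE g0 g1]] := c_curve H X0 X1 Y0.
have -> : xt = gam t.
  apply: (cd_gy_inj H Y0 Xt (Xg _ t01)).
  by apply: oppr_inj; rewrite -!gyE in tE; rewrite tE (gE _ t01); apply/esym; exact: opp_segment.
pose u := gy x1 y0 - gy x0 y0.
pose f := cdiff c y y0 \o gam.
pose df s := 'd (cdiff c y y0) (gam s) (u *m invmx (M (gam s) y0)).
have dF z : X z -> differentiable (cdiff c y y0) z.
  by move=> Xz; exact: (cdiff_differentiable H Xz Yy Y0).
have gi z1 z2 (h1 : X z1) (h2 : X z2) := cd_gy_inj H Y0 h1 h2.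
have gd z (h : X z) := cd_dgy H h Y0.
have gdE z k (h : X z) := cd_dgyE H k h Y0.
have gU z (h : X z) := cd_unit H h Y0.
have cf : {within `[0, 1], continuous f}.
  exact: (curve_continuous (cd_cX H) gi gd gdE gU dF Xg gE).
have df' (s : R) : s \in `]0, 1[ -> is_derive s 1 f (df s).
  exact: (curve_derive (cd_cX H) gi gd gdE gU dF Xg gE).
have dfE s : 0 <= s <= 1 ->
    df s = - dot (u *m invmx (M (gam s) y0)) (gx (gam s) y - gx (gam s) y0).
  by move=> s01; rewrite /df (diff_cdiff H _ (Xg _ s01) Yy Y0).
have := @quasiconvex_first_order R f df cf df' _ _ t t01.
rewrite /f /cdiff /= g0 g1; apply.
- move=> s; rewrite in_itv/= => /andP[s0 s1] fs.
  have s01 : 0 <= s <= 1 by rewrite !ltW.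
  have E : gy x0 y0 - gy (gam s) y0 = - s *: u.
    by rewrite (gE _ s01); exact: sub_segment0.
  have := L x0 (gam s) y y0 X0 (Xg _ s01) Yy Y0.
  rewrite (@slope_scale _ _ gx gy M _ _ _ _ _ _ E) -(dfE _ s01).
  rewrite mulNr oppr_le0 pmulr_rge0//; apply.
  by rewrite /cross; lra.
- move=> s; rewrite in_itv/= => /andP[s0 s1] fs.
  have s01 : 0 <= s <= 1 by rewrite !ltW.
  have E : gy x1 y0 - gy (gam s) y0 = (1 - s) *: u.
    by rewrite (gE _ s01); exact: sub_segment1.
  have := L x1 (gam s) y y0 X1 (Xg _ s01) Yy Y0.
  rewrite (@slope_scale _ _ gx gy M _ _ _ _ _ _ E) -(dfE _ s01).
  rewrite pmulr_rle0 ?subr_gt0//; apply.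
  by rewrite /cross; lra.
Qed.

End CrossCondition.

Lemma mulmxr_continuous (R : realType) n (N : 'M[R]_n) :
  continuous (fun u : 'rV[R]_n => u *m N).
Proof.
move=> u; apply/(@cvgrPdist_lt _ _ _ (nbhs u) _ (fun u => u *m N) (u *m N)) => e e0.
have C0 : 0 < n%:R * `|N| + 1 by rewrite ltr_wpDl// mulr_ge0.
have d0 : 0 < e / (n%:R * `|N| + 1) by rewrite divr_gt0.
apply/near_normP; exists (e / (n%:R * `|N| + 1)) => // z.
rewrite ltr_pdivlMr// => zu; rewrite -mulmxBl.
apply: le_lt_trans (mulmx_norm_le _ _) _; rewrite distrC; apply: le_lt_trans zu.
by rewrite mulrC ler_wpM2l// lerDl.
Qed.

Lemma seq_common_radius (R : realType) (T : eqType) (l : seq T)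
    (P : T -> R -> Prop) :
  (forall x, x \in l -> exists2 d, 0 < d & forall s, 0 < s < d -> P x s) ->
  exists2 d, 0 < d & forall s, 0 < s < d -> forall x, x \in l -> P x s.
Proof.
elim: l => [|x l IH] Hl; first by exists 1.
have [d d0 Hd] := Hl x (mem_head _ _).
have [z zl|d' d'0 Hd'] := IH; first by apply: Hl; rewrite inE zl orbT.
exists (Num.min d d'); first by rewrite lt_min d0.
move=> s; rewrite lt_min => /and3P[s0 sd sd'] z; rewrite inE => /orP[/eqP ->|zl].
  by apply: Hd; rewrite s0.
by apply: Hd' => //; rewrite s0.
Qed.

Section GradyInverse.
Variables (R : realType) (n : nat).
Notation V := 'rV[R]_n.
Variables (X Y : set V) (c : V -> V -> R) (gx gy : V -> V -> V)
  (M : V -> V -> 'M[R]_n).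
Hypothesis H : cost_data X Y c gx gy M.
Implicit Types x y : V.

Lemma inner_gy y : Y y ->
  exists2 x, X x & inner [set gy x' y | x' in X] (gy x y).
Proof.
move=> Yy; have [x iX] := cd_iX H; have Xx := interior_subset iX.
exists x => //; apply: (@inner_image_interior _ _ X (fun x' => gy x' y) x (M x y)).
- exact: iX.
- exact: (cd_dgy H Xx Yy).
- by move=> k; exact: (cd_dgyE H k Xx Yy).
- exact: (cd_unit H Xx Yy).
Qed.

Lemma gy_inverse_continuous x0 y r : X x0 -> Y y -> 0 < r ->
  exists2 d, 0 < d & forall x, X x -> `|gy x y - gy x0 y| < d -> `|x - x0| < r.
Proof.
move=> X0 Yy r0.
apply: (@inverse_continuous _ _ X (fun x => gy x y) (cd_cX H)) => //.
- by move=> z Xz; apply: differentiable_continuous; exact: (cd_dgy H Xz Yy).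
- by move=> z1 z2 Z1 Z2; exact: (cd_gy_inj H Yy Z1 Z2).
Qed.

Lemma cost_continuous_x x y : X x -> Y y -> {for x, continuous (fun x' => c x' y)}.
Proof.
by move=> Xx Yy; apply: differentiable_continuous; exact: (cd_dcx H Xx Yy).
Qed.

(** Controls the cost by the coordinate [gy _ y0], in which c-segments with respect to [y0] are
    straight. *)
Lemma cost_eps_gy x0 y0 y e : X x0 -> Y y0 -> Y y -> 0 < e ->
  exists2 d, 0 < d & forall x, X x -> `|gy x y0 - gy x0 y0| < d ->
    `|c x y - c x0 y| < e.
Proof.
move=> X0 Y0 Yy e0.
have [r r0 Hr] := continuous_eps (cost_continuous_x X0 Yy) e0.
have [d d0 Hd] := gy_inverse_continuous X0 Y0 r0.
by exists d => // x Xx xd; exact: Hr (Hd x Xx xd).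
Qed.

End GradyInverse.

Section GradxInverse.
Variables (R : realType) (n : nat).
Notation V := 'rV[R]_n.
Variables (X Y : set V) (c : V -> V -> R) (gx gy : V -> V -> V)
  (M : V -> V -> 'M[R]_n).
Hypothesis H : cost_data X Y c gx gy M.
Implicit Types x y : V.
Let H' := cost_data_swap H.

Lemma inner_gx x : X x -> exists2 y, Y y & inner [set gx x y' | y' in Y] (gx x y).
Proof. exact: (inner_gy H'). Qed.

Lemma cost_continuous_y x y : X x -> Y y -> {for y, continuous (fun y' => c x y')}.
Proof. by move=> Xx Yy; exact: (cost_continuous_x H' Yy Xx). Qed.

Lemma cost_eps_gx x0 x y0 e : X x0 -> X x -> Y y0 -> 0 < e ->
  exists2 d, 0 < d & forall y, Y y -> `|gx x0 y - gx x0 y0| < d ->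
    `|c x y - c x y0| < e.
Proof. by move=> X0 Xx Y0; exact: (cost_eps_gy H' Y0 X0 Xx). Qed.

Lemma c_curve_y x y0 y1 : X x -> Y y0 -> Y y1 -> exists gam : R -> V,
  [/\ forall t, 0 <= t <= 1 -> Y (gam t),
      forall t, 0 <= t <= 1 ->
        gx x (gam t) = gx x y0 + t *: (gx x y1 - gx x y0),
      gam 0 = y0 & gam 1 = y1].
Proof. by move=> Xx Y0 Y1; exact: (c_curve H' Y0 Y1 Xx). Qed.

(** Separates the dependence on [y] from that on [x], as [minimax_alternative] requires. *)
Lemma slope_dot x xb y y0 : slope gx gy M x xb y y0 =
  dot ((gx xb y - gx xb y0) *m - (invmx (M xb y0))^T) (gy x y0 - gy xb y0).
Proof. by rewrite /slope mulmxN dotNl dotMl dotC. Qed.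

Definition slope_dir x xb y0 := - ((gy x y0 - gy xb y0) *m invmx (M xb y0)).

Lemma slope_dirE x xb y y0 : slope gx gy M x xb y y0 =
  dot (gx xb y - gx xb y0) (slope_dir x xb y0).
Proof. by rewrite /slope dotC -dotNr. Qed.

Lemma slope_dir_neq0 x xb y0 : X x -> X xb -> Y y0 -> x != xb ->
  slope_dir x xb y0 != 0.
Proof.
move=> Xx Xb Y0; apply: contra_neq => E.
apply: (cd_gy_inj H Y0 Xx Xb); apply/eqP; rewrite -subr_eq0; apply/eqP.
rewrite -[LHS](mulmxKV (cd_unit H Xb Y0)) -[_ *m invmx _]opprK -/(slope_dir _ _ _).
by rewrite E oppr0 mul0mx.
Qed.

Hypothesis CC : cross_condition X Y c gx gy M.

(** If [cross] were negative at [y], moving [y] slightly towards a slope [ys] where [slope] is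
    positive would keep [cross] nonpositive and make [slope] positive, against the first-order
    condition. *)
Lemma slope_ge0_cross x xb yb : X x -> X xb -> Y yb -> x != xb ->
  (forall y, Y y -> 0 <= slope gx gy M x xb y yb) ->
  forall y, Y y -> 0 <= cross c x xb y yb.
Proof.
move=> Xx Xb Yb xxb S0 y Yy; rewrite leNgt; apply/negP => cr.
have w0 := slope_dir_neq0 Xx Xb Yb xxb.
pose w := slope_dir x xb yb.
have [ys Ys Is] := inner_gx Xb.
(* [ys] is inner, so some [y2] has a strictly smaller [slope]; that one being nonnegative, the one
   at [ys] is positive. *)
have [|_ [y2 Y2 <-] /=] := Is (- w); first by rewrite oppr_eq0.
rewrite dotNr => Hy2.
have Ss : 0 < slope gx gy M x xb ys yb.
  have := S0 y2 Y2; rewrite !slope_dirE.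
  have -> : gx xb y2 - gx xb yb = (gx xb y2 - gx xb ys) + (gx xb ys - gx xb yb).
    by rewrite addrA subrK.
  by rewrite dotDl -/w; lra.
have [gam [Yg gE _ _]] := c_curve_y Xb Yy Ys.
have e0 : 0 < - cross c x xb y yb / 2 by lra.
have [d1 d10 Hd1] := cost_eps_gx Xb Xx Yy e0.
have [d2 d20 Hd2] := cost_eps_gx Xb Xb Yy e0.
pose u := gx xb ys - gx xb y.
have u1 : 0 < `|u| + 1 by rewrite ltr_wpDl.
pose d := Num.min (Num.min d1 d2) 1.
have d0 : 0 < d by rewrite !lt_min d10 d20 ltr01.
have dle1 : d <= 1 by rewrite ge_min lexx orbT.
pose s := d / (`|u| + 1).
have s0 : 0 < s by rewrite divr_gt0.
have su : s * (`|u| + 1) = d by rewrite divfK// gt_eqF.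
have s01 : 0 <= s <= 1.
  rewrite ltW//= ler_pdivrMr// mul1r; apply: le_trans dle1 _.
  by rewrite lerDr.
have gd : `|gx xb (gam s) - gx xb y| < Num.min d1 d2.
  rewrite gE// addrC addKr normrZ gtr0_norm// -/u.
  have : d <= Num.min d1 d2 by rewrite ge_min lexx.
  by rewrite -su mulrDr mulr1; lra.
move: gd; rewrite lt_min => /andP[/(Hd1 _ (Yg _ s01)) + /(Hd2 _ (Yg _ s01))].
rewrite !ltr_norml => /andP[h1 h2] /andP[h3 h4].
have crs : cross c x xb (gam s) yb <= 0 by move: h1 h2 h3 h4; rewrite /cross; lra.
have := CC Xx Xb (Yg _ s01) Yb crs.
rewrite slope_dirE gE//.
have -> : gx xb y + s *: (gx xb ys - gx xb y) - gx xb yb =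
   (1 - s) *: (gx xb y - gx xb yb) + s *: (gx xb ys - gx xb yb).
  by apply/rowP => i; rewrite !mxE; ring.
rewrite dotDl !dotZl -!slope_dirE.
have : 0 < s * slope gx gy M x xb ys yb by rewrite mulr_gt0.
have : 0 <= (1 - s) * slope gx gy M x xb y yb.
  by rewrite mulr_ge0 ?subr_ge0 ?S0//; case/andP: s01.
lra.
Qed.

End GradxInverse.

(** * Alternative c-convex functions under Loeper's property *)

Section SupportCharacterisation.
Variables (R : realType) (n : nat).
Notation V := 'rV[R]_n.
Variables (X Y : set V) (c : V -> V -> R).
Hypotheses (X0 : X !=set0) (cY : compact Y).
Hypothesis cont_c : forall x y, X x -> Y y -> {for y, continuous (fun y' => c x y')}.

(** Each c-affine function in the supremum defining [phi] lies below [phi], hence is admissible in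
    every chord. *)
Lemma c_convex_alt (phi : V -> R) : c_convex_fun X Y c phi -> alt_c_convex_fun X Y c phi.
Proof.
move=> [psi [psiN [_ E]]] x0 x1 Xx0 Xx1 x Xx; rewrite (E x Xx).
apply: ge_ereal_sup => _ [y Yy <-].
case Epsi : (psi y) => [h||]; last first.
- by rewrite leNye.
- by have := psiN y Yy; rewrite Epsi.
have below z : X z -> - c z y + h <= phi z.
  move=> Xz; rewrite -lee_fin (E z Xz) EFinD -Epsi.
  by apply: ereal_sup_ubound; exists y.
rewrite -EFinD; apply: ereal_sup_ubound; exists y, h.
by split => //; exact: below.
Qed.

(** [psi] is the c-transform of [phi]; a supporting slope is one where its infimum is attained at
    [xb]. *)
Lemma support_c_convex (phi : V -> R) :
  (forall xb, X xb -> exists2 y, Y y &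
     forall x, X x -> phi xb - c x y + c xb y <= phi x) ->
  c_convex_fun X Y c phi.
Proof.
move=> sup; have [a Xa] := X0.
pose psi y := ereal_inf [set (phi x + c x y)%:E | x in X].
have psi_sup xb y : X xb -> (forall x, X x -> phi xb - c x y + c xb y <= phi x) ->
    psi y = (phi xb + c xb y)%:E.
  move=> Xb Hy; apply/eqP; rewrite eq_le; apply/andP; split.
    by apply: ereal_inf_lbound; exists xb.
  apply: le_ereal_inf_tmp => _ [x Xx <-]; rewrite lee_fin.
  by have := Hy x Xx; lra.
exists psi; split; [|split].
- move=> y Yy; apply/negP => /eqP E.
  have : (psi y <= (phi a + c a y)%:E)%E by apply: ereal_inf_lbound; exists a.
  by rewrite E leye_eq.
- have [y Yy Hy] := sup a Xa; exists y; split => //.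
  by rewrite (psi_sup a y Xa Hy).
- move=> x Xx; apply/eqP; rewrite eq_le; apply/andP; split.
    have [y Yy Hy] := sup x Xx; apply: ereal_sup_ubound; exists y => //.
    by rewrite (psi_sup x y Xx Hy) -EFinD; congr EFin; ring.
  apply: ge_ereal_sup => _ [y Yy <-].
  have : (psi y <= (phi x + c x y)%:E)%E by apply: ereal_inf_lbound; exists x.
  case: (psi y) => [h||].
  - by rewrite lee_fin -EFinD lee_fin; lra.
  - by rewrite leye_eq.
  - by move=> _; rewrite leNye.
Qed.

(** The supremum is attained although [psi] need not be continuous. If no slope supports [phi] at
    [xb], compactness of [Y] gives a uniform margin [d] of failure, and the supremum at [xb] is at
    most [phi xb - d]. *)
Lemma c_convex_support (phi : V -> R) xb : c_convex_fun X Y c phi -> X xb ->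
  exists2 y, Y y & forall x, X x -> phi xb - c x y + c xb y <= phi x.
Proof.
move=> [psi [psiN [_ E]]] Xb; apply: contrapT => no.
pose P (i : V * R) (y : V) := phi i.1 < phi xb - c i.1 y + c xb y - i.2.
have [y Yy|l Dl Hl] := @compact_finite_cover _ _ Y
    [set i : V * R | X i.1 /\ 0 < i.2] P cY.
  have [x Xx Hx] : exists2 x, X x & phi x < phi xb - c x y + c xb y.
    apply: contrapT => Hx; apply: no; exists y => // x Xx.
    by rewrite leNgt; apply/negP => ?; apply: Hx; exists x.
  (* A quarter of the gap leaves room for two continuity errors and for the margin. *)
  pose e := (phi xb - c x y + c xb y - phi x) / 4.
  have e0 : 0 < e by rewrite /e; lra.
  exists (x, e); first by [].
  have [r1 r10 H1] := continuous_eps (cont_c Xx Yy) e0.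
  have [r2 r20 H2] := continuous_eps (cont_c Xb Yy) e0.
  apply/near_normP; exists (Num.min r1 r2); first by rewrite lt_min r10.
  move=> z; rewrite lt_min => /andP[/H1 + /H2 + _]; rewrite !ltr_norml.
  by move=> /andP[h1 h2] /andP[h3 h4]; rewrite /P /= /e in h1 h2 h3 h4 *; lra.
have [i|d d0 Hd] := @pos_seq_min R [seq i.2 | i <- l].
  by move=> /mapP[j /Dl[_ ?] ->].
have : ((phi xb)%:E <= (phi xb - d)%:E)%E.
  rewrite {1}(E xb Xb); apply: ge_ereal_sup => _ [y Yy <-].
  have [i il Pi] := Hl y Yy; have [Xi i0] := Dl i il.
  have di : d <= i.2 by apply: Hd; apply/mapP; exists i.
  have : ((- c i.1 y)%:E + psi y <= (phi i.1)%:E)%E.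
    by rewrite (E _ Xi); apply: ereal_sup_ubound; exists y.
  case: (psi y) => [h||].
  - by rewrite -!EFinD !lee_fin; move: Pi; rewrite /P; lra.
  - by rewrite leye_eq.
  - by move=> _; rewrite leNye.
by rewrite lee_fin; lra.
Qed.

End SupportCharacterisation.

(** * Supporting slopes of alternative c-convex functions *)

Section AltToConvex.
Variables (R : realType) (n : nat).
Notation V := 'rV[R]_n.
Variables (X Y : set V) (c : V -> V -> R) (gx gy : V -> V -> V)
  (M : V -> V -> 'M[R]_n).
Hypothesis H : cost_data X Y c gx gy M.
Hypothesis gyE : forall x y, gy x y = grady c x y.
Hypothesis L : Loeper X Y c.
Variable phi : V -> R.
Hypothesis alt : alt_c_convex_fun X Y c phi.

(** By Loeper's property, a c-affine function admissible for the chord between [a] and [b] obeys the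
    bound [m - c xt yb] at every point [xt] of the c-segment. *)
Lemma sublevel_cvx yb m : Y yb ->
  cvx [set gy x yb | x in [set x | X x /\ phi x + c x yb <= m]].
Proof.
move=> Yb _ _ t [a [Xa am] <-] [b [Xb bm] <-] t01.
have vX := cd_gy_cvx H Yb.
have [||xt Xt xtE] := vX (gy a yb) (gy b yb) t _ _ t01; [by exists a|by exists b|].
exists xt => //; split => //.
suff : ((phi xt)%:E <= (m - c xt yb)%:E)%E by rewrite lee_fin; lra.
apply: le_trans (alt Xb Xa Xt) _; apply: ge_ereal_sup => _ [y [h [Yy h1 h2 ->]]].
rewrite lee_fin.
have : - c xt y + c xt yb <= Num.max (- c b y + c b yb) (- c a y + c a yb).
  apply: L => //; split => //; exists t; split => //.
  by rewrite -!gyE xtE !scalerN opprD.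
rewrite le_max => /orP[]; lra.
Qed.

Let CC : cross_condition X Y c gx gy M := Loeper_cross_condition H gyE L.

(** [yb] maximises the least margin [G]. If [G yb] fell short of [phi xb], either some change of
    slope would raise all active margins at once, or a degenerate chord at a point [xs] would bound
    [phi xb] by [G yb]. *)
Lemma finite_support xb (l : seq V) : X xb -> (forall x, x \in l -> X x) ->
  exists2 y, Y y & forall x, x \in l -> phi xb - c x y + c xb y <= phi x.
Proof.
move=> Xb Xl.
have [y0 Yy0] := cd_iY H; have {}Yy0 := interior_subset Yy0.
case: l Xl => [|x0 l Xl]; first by exists y0.
pose h x y := phi x + c x y - c xb y.
pose G y := foldr (fun x m => Num.min (h x y) m) (h x0 y) l.
have GE y : (forall x, x \in x0 :: l -> G y <= h x y) /\
    exists2 x, x \in x0 :: l & G y = h x y.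
  rewrite /G; elim: l {Xl G} => [|x l [IH1 [z zl IH2]]] /=.
    by split; [move=> x; rewrite inE => /eqP ->|exists x0; rewrite ?inE].
  split.
    move=> u; rewrite !inE => /or3P[/eqP ->|/eqP ->|ul]; rewrite ge_min.
    - by rewrite IH1 ?orbT// mem_head.
    - by rewrite lexx.
    - by rewrite IH1 ?orbT// inE ul orbT.
  have [le|le] := leP (h x y) (foldr (fun x m => Num.min (h x y) m) (h x0 y) l).
    by exists x => //; rewrite !inE eqxx orbT.
  by exists z => //; move: zl; rewrite !inE => /orP[->|->]; rewrite ?orbT.
have h_eps x y e : X x -> Y y -> 0 < e -> exists2 r, 0 < r &
    forall z, `|z - y| < r -> `|h x z - h x y| < e.
  move=> Xx Yy e0; have e2 : 0 < e / 2 by rewrite divr_gt0.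
  have [r1 r10 H1] := continuous_eps (cost_continuous_y H Xx Yy) e2.
  have [r2 r20 H2] := continuous_eps (cost_continuous_y H Xb Yy) e2.
  exists (Num.min r1 r2); first by rewrite lt_min r10.
  move=> z; rewrite lt_min => /andP[/H1 + /H2]; rewrite !ltr_norml.
  by move=> /andP[h1 h2] /andP[h3 h4]; rewrite /h; apply/andP; split; lra.
have [|v b Yv Gb|yb Yb Gmax] := @usc_compact_max R V Y G (cd_cY H).
- by exists y0.
- have [_ [x xl Ge]] := GE v.
  have e0 : 0 < b - h x v by rewrite -Ge; lra.
  have [r r0 Hr] := h_eps x v _ (Xl _ xl) Yv e0.
  apply/near_normP; exists r => // z /Hr; rewrite ltr_norml => /andP[_ hz] _.
  by have [/(_ x xl) + _] := GE z; lra.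
have [Gphi|Gphi] := leP (phi xb) (G yb).
  exists yb => // x xl; have [/(_ x xl) + _] := GE yb.
  by rewrite /h; lra.
exfalso.
pose K := [seq x <- x0 :: l | h x yb == G yb].
pose vel x := gy x yb - gy xb yb.
have [|C [cC vC KC subC]] := @finite_hull R n [seq vel x | x <- K].
  have [_ [x xl Ge]] := GE yb.
  have : x \in K by rewrite mem_filter Ge eqxx.
  by case: K.
(* In these coordinates [slope] becomes [dot] between a point of [P] and a velocity, by
   [slope_dot]. *)
pose N := - (invmx (M xb yb))^T.
pose P := [set (p - gx xb yb) *m N | p in [set gx xb y | y in Y]].
have velC x : x \in K -> C (vel x) by move=> xK; apply: KC; exact: map_f.
have cP : compact P.
  rewrite /P image_comp; apply: continuous_compact (cd_cY H).
  apply: continuous_in_subspaceT => y; rewrite inE => Yy.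
  apply: (@continuous_comp _ _ _ (fun y => gx xb y - gx xb yb) (fun u => u *m N)).
    apply: continuousB; last exact: cst_continuous.
    by apply: differentiable_continuous; exact: (cd_dgx H Xb Yy).
  exact: mulmxr_continuous.
have vP : cvx P by apply: cvx_image_affine; exact: (cd_gx_cvx H Xb).
have P0 : P 0 by exists (gx xb yb); [exists yb|rewrite subrr mul0mx].
have C0 : C !=set0.
  have [_ [x xl Ge]] := GE yb; exists (vel x); apply: velC.
  by rewrite mem_filter Ge eqxx.
have [[p [_ [y1 Y1 <-] <-] Hp]|[v Cv Hv]] := minimax_alternative cP vP P0 cC vC C0.
  (* First alternative: moving from [yb] towards [y1] makes [cross] negative at the active points,
     that is, raises their margins. The other margins stay above [G yb] by continuity, so [yb] was
     not optimal. *)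
  have [gam [Yg gE _ _]] := c_curve_y H Xb Yb Y1.
  pose Q x s := forall z, Y z ->
    gx xb z = gx xb yb + s *: (gx xb y1 - gx xb yb) -> G yb < h x z.
  have [x xl|d d0 Hd] := @seq_common_radius R V (x0 :: l) Q.
    have [xK|xK] := eqVneq (h x yb) (G yb).
      have S0 : slope gx gy M x xb y1 yb < 0.
        by rewrite slope_dot; apply: Hp; apply: velC; rewrite mem_filter xK eqxx.
      have [|d d0 Hd] := cross_sign_y H (Xl _ xl) Xb Y1 Yb; first by rewrite lt_eqF.
      exists d => // s sd z Yz zE; have := Hd s z sd Yz zE.
      rewrite nmulr_lgt0// -xK /cross /h; lra.
    have lt : 0 < h x yb - G yb.
      by rewrite subr_gt0 lt_neqAle eq_sym xK; have [/(_ x xl)] := GE yb.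
    have [r r0 Hr] := h_eps x yb _ (Xl _ xl) Yb lt.
    have [d d0 Hd] := gy_inverse_continuous (cost_data_swap H) Yb Xb r0.
    have u1 : 0 < `|gx xb y1 - gx xb yb| + 1 by rewrite ltr_wpDl.
    exists (d / (`|gx xb y1 - gx xb yb| + 1)); first by rewrite divr_gt0.
    move=> s /andP[s0]; rewrite ltr_pdivlMr// => sd z Yz zE.
    have := Hr z; rewrite ltr_norml => /(_ _)/andP[].
      apply: Hd => //; rewrite /swap zE addrC addKr normrZ gtr0_norm//.
      by apply: le_lt_trans sd; rewrite ler_pM2l// lerDl.
    by lra.
  pose s := Num.min d 1 / 2.
  have m0 : 0 < Num.min d 1 by rewrite lt_min d0 ltr01.
  have md : Num.min d 1 <= d by rewrite ge_min lexx.
  have m1 : Num.min d 1 <= 1 by rewrite ge_min lexx orbT.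
  have sd : 0 < s < d by rewrite /s; lra.
  have s01 : 0 <= s <= 1 by rewrite /s; lra.
  have [_ [x xl Ge]] := GE (gam s).
  have := Hd s sd x xl (gam s) (Yg _ s01) (gE _ s01).
  by rewrite -Ge ltNge Gmax//; exact: Yg.
(* At this level the sublevel set contains all active points, hence a point [xs] with velocity
   [v]. *)
pose m := G yb + c xb yb.
have vS := @cvx_image_affine _ _ _ 1%:M (gy xb yb) (sublevel_cvx (m := m) Yb).
have [_ [xs [Xs xsm] <-] vE] : [set (a - gy xb yb) *m 1%:M | a in
    [set gy x yb | x in [set x | X x /\ phi x + c x yb <= m]]] v.
  apply: (subC _ vS _ v Cv) => w /mapP[x + ->].
  rewrite mem_filter => /andP[/eqP xG xl].
  exists (gy x yb); last by rewrite mulmx1.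
  exists x => //; split; first exact: Xl.
  by rewrite /m -xG /h; lra.
rewrite mulmx1 in vE.
have xxb : xs != xb.
  by apply/eqP => E; move: xsm Gphi; rewrite E /m; lra.
have cr : forall y, Y y -> 0 <= cross c xs xb y yb.
  apply: (slope_ge0_cross H CC Xs Xb Yb xxb) => y Yy.
  rewrite slope_dot vE; apply: Hv; exists (gx xb y) => //.
  by exists y.
have : ((phi xb)%:E <= (G yb)%:E)%E.
  apply: le_trans (alt Xs Xs Xb) _; apply: ge_ereal_sup => _ [y [k [Yy h1 h2 ->]]].
  by rewrite lee_fin; have := cr y Yy; move: xsm; rewrite /cross /m; lra.
by rewrite lee_fin; lra.
Qed.

(** If every slope failed to support [phi] at [xb], compactness of [Y] would leave finitely many
    points witnessing all the failures, against [finite_support]. *)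
Lemma alt_c_convex : c_convex_fun X Y c phi.
Proof.
apply: support_c_convex.
  by have [x iX] := cd_iX H; exists x; exact: interior_subset.
move=> xb Xb; apply: contrapT => no.
pose P (x y : V) := phi x < phi xb - c x y + c xb y.
have [y Yy|l Xl Hl] := @compact_finite_cover _ _ Y X P (cd_cY H).
  have [x Xx Hx] : exists2 x, X x & phi x < phi xb - c x y + c xb y.
    apply: contrapT => Hx; apply: no; exists y => // x Xx.
    by rewrite leNgt; apply/negP => ?; apply: Hx; exists x.
  pose e := (phi xb - c x y + c xb y - phi x) / 2.
  have e0 : 0 < e by rewrite /e; lra.
  exists x; first by [].
  have [r1 r10 H1] := continuous_eps (cost_continuous_y H Xx Yy) e0.
  have [r2 r20 H2] := continuous_eps (cost_continuous_y H Xb Yy) e0.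
  apply/near_normP; exists (Num.min r1 r2); first by rewrite lt_min r10.
  move=> z; rewrite lt_min => /andP[/H1 + /H2 + _]; rewrite !ltr_norml.
  by move=> /andP[h1 h2] /andP[h3 h4]; rewrite /P /= /e in h1 h2 h3 h4 *; lra.
have [y Yy Hy] := finite_support Xb Xl.
by have [x /Hy + Px] := Hl y Yy; rewrite /P in Px; lra.
Qed.

End AltToConvex.

(** * Failure of Loeper's property *)

Section InverseMatrix.
Variables (R : realType) (n : nat).

Lemma trmx_norm_le m p (A : 'M[R]_(m, p)) : `|A^T| <= `|A|.
Proof. by apply: norm_le_coord => // i j; rewrite mxE coord_le_norm. Qed.

Lemma mulmx_norm_le_mx (A B : 'M[R]_n) : `|A *m B| <= n%:R * `|B| * `|A|.
Proof.
apply: norm_le_coord => [|i j]; first by rewrite !mulr_ge0.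
have -> : (A *m B) i j = (row i A *m B) 0 j by rewrite -row_mul [RHS]mxE.
apply: le_trans (coord_le_norm _ _ _) _; apply: le_trans (mulmx_norm_le _ _) _.
rewrite ler_wpM2l ?mulr_ge0//; apply: norm_le_coord => // k l.
by rewrite mxE coord_le_norm.
Qed.

(** From [J - I = I *m ((A - B) *m J)]. The first bound on [r] absorbs half of the norm of [J], so
    that [J] is at most twice [I] in norm. *)
Lemma invmx_eps (A : 'M[R]_n) e : A \in unitmx -> 0 < e ->
  exists2 r, 0 < r & forall B, B \in unitmx -> `|B - A| < r ->
    `|invmx B - invmx A| < e.
Proof.
move=> uA e0; set I := invmx A.
pose K : R := n%:R * n%:R * `|I| + 1.
have K0 : 0 < K by rewrite ltr_wpDl// !mulr_ge0.
pose r := Num.min (1 / (2 * K)) (e / (2 * K * `|I| + 1)).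
have D0 : 0 < 2 * K * `|I| + 1 by rewrite ltr_wpDl// !mulr_ge0// ltW.
exists r; first by rewrite lt_min !divr_gt0// mulr_gt0.
move=> B uB; rewrite lt_min => /andP[]; set J := invmx B; set d := `|B - A|.
rewrite !ltr_pdivlMr ?mulr_gt0// => h1 h2.
have E : J - I = I *m ((A - B) *m J).
  by rewrite mulmxBl mulmxV// mulmxBr mulmx1 mulmxA mulVmx// mul1mx.
have JI : `|J - I| <= K * d * `|J|.
  rewrite E; apply: le_trans (mulmx_norm_le_mx _ _) _.
  have := mulmx_norm_le_mx (A - B) J; rewrite [`|A - B|]distrC -/d => h.
  apply: (@le_trans _ _ (n%:R * (n%:R * `|J| * d) * `|I|)).
    by rewrite ler_wpM2r// ler_wpM2l.
  have : 0 <= d * `|J| by apply: mulr_ge0; exact: normr_ge0.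
  by rewrite /K; lra.
have JJ : `|J| <= `|I| + `|J - I|.
  by have := ler_normD I (J - I); rewrite addrC subrK.
have hd : K * d * `|J| <= 1 / 2 * `|J| by rewrite ler_wpM2r//; lra.
have J2 : `|J| <= 2 * `|I| by lra.
apply: le_lt_trans JI _.
have d0 : 0 <= d by exact: normr_ge0.
have : K * d * `|J| <= K * d * (2 * `|I|) by rewrite ler_wpM2l// mulr_ge0// ltW.
by move: h2 d0; lra.
Qed.

Lemma unit_sphere_compact : compact [set w : 'rV[R]_n | `|w| = 1].
Proof.
apply: bounded_closed_compact.
  exists 1; split; first exact: num_real.
  by move=> M M1 w /= ->; rewrite ltW.
rewrite (_ : [set w | _] = (fun w : 'rV[R]_n => `|w|) @^-1` [set 1])//.
by apply: closed_comp; [move=> w _; exact: norm_continuous|exact: closed_eq].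
Qed.

End InverseMatrix.

(** * Finitely many slopes separating the points near [xb] *)

Section LocalDescent.
Variables (R : realType) (n : nat).
Notation V := 'rV[R]_n.
Variables (X Y : set V) (c : V -> V -> R) (gx gy : V -> V -> V)
  (M : V -> V -> 'M[R]_n).
Hypothesis H : cost_data X Y c gx gy M.
Hypothesis gx_eps : forall x y e, X x -> Y y -> 0 < e ->
  exists2 r, 0 < r & forall z, X z -> `|z - x| < r -> `|gx z y - gx x y| < e.
Hypothesis M_eps : forall x y e, X x -> Y y -> 0 < e ->
  exists2 r, 0 < r & forall z, X z -> `|z - x| < r -> `|M z y - M x y| < e.
Implicit Types x y : V.

(** Represents the derivative of [cdiff c y y0] at [x] in the coordinate [gy _ y0]. *)
Definition descent_dir x y y0 := - ((gx x y - gx x y0) *m (invmx (M x y0))^T).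

Lemma descent_dirE x y y0 w : X x -> Y y -> Y y0 ->
  'd (cdiff c y y0) x (w *m invmx (M x y0)) = dot w (descent_dir x y y0).
Proof.
by move=> Xx Yy Y0; rewrite (diff_cdiff H _ Xx Yy Y0) /descent_dir dotNr dotMl.
Qed.

Lemma descent_dir_eps x y y0 e : X x -> Y y -> Y y0 -> 0 < e ->
  exists2 r, 0 < r & forall z, X z -> `|z - x| < r ->
    `|descent_dir z y y0 - descent_dir x y y0| < e.
Proof.
move=> Xx Yy Y0 e0.
set I := invmx (M x y0); set u := gx x y - gx x y0.
pose K : R := n%:R * (`|I| + 1) + n%:R * `|u| + 1.
have K0 : 0 < K by rewrite ltr_wpDl// addr_ge0// mulr_ge0// addr_ge0.
pose f := Num.min 1 (e / (3 * K)).
have f0 : 0 < f by rewrite lt_min ltr01 divr_gt0// mulr_gt0.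
have f1 : f <= 1 by rewrite ge_min lexx.
have fK : f * (3 * K) <= e by rewrite -ler_pdivlMr ?mulr_gt0// ge_min lexx orbT.
have [r1 r10 H1] := gx_eps Xx Yy f0.
have [r2 r20 H2] := gx_eps Xx Y0 f0.
have [r3 r30 H3] := invmx_eps (cd_unit H Xx Y0) f0.
have [r4 r40 H4] := M_eps Xx Y0 r30.
exists (Num.min (Num.min r1 r2) r4); first by rewrite !lt_min r10 r20.
move=> z Xz; rewrite !lt_min => /andP[/andP[/(H1 _ Xz) h1 /(H2 _ Xz) h2]].
move=> /(H4 _ Xz)/(H3 _ (cd_unit H Xz Y0)).
rewrite -/I; set J := invmx _ => h3.
have -> : descent_dir z y y0 - descent_dir x y y0 =
    - (((gx z y - gx x y) - (gx z y0 - gx x y0)) *m J^T + u *m (J - I)^T).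
  rewrite /descent_dir -/J -/I -/u.
  have -> : (J - I)^T = J^T - I^T by apply/matrixP => i j; rewrite !mxE.
  have -> : gx z y - gx x y - (gx z y0 - gx x y0) = gx z y - gx z y0 - u.
    by apply/rowP => i; rewrite !mxE; ring.
  clear; move: (gx z y - gx z y0) (u) => v u'; rewrite mulmxBl mulmxBr.
  move: (v *m J^T) (u' *m J^T) (u' *m I^T) => a b e'.
  by apply/rowP => i; rewrite !mxE; ring.
rewrite normrN; apply: le_lt_trans (ler_normD _ _) _.
have JI : `|J| <= `|I| + 1.
  have := ler_normD I (J - I); rewrite addrC subrK; lra.
have b1 : `|(gx z y - gx x y - (gx z y0 - gx x y0)) *m J^T| <=
    n%:R * (`|I| + 1) * (f + f).
  apply: le_trans (mulmx_norm_le _ _) _; apply: ler_pM => //.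
  - by rewrite ler_wpM2l//; apply: le_trans JI; exact: trmx_norm_le.
  - by apply: le_trans (ler_normB _ _) _; rewrite lerD// ltW.
have b2 : `|u *m (J - I)^T| <= n%:R * f * `|u|.
  apply: le_trans (mulmx_norm_le _ _) _; rewrite ler_wpM2r// ler_wpM2l//.
  by apply: le_trans (trmx_norm_le _) _; exact: ltW.
apply: le_lt_trans (lerD b1 b2) _; apply: lt_le_trans fK.
have a0 : 0 <= n%:R * (`|I| + 1) * f by rewrite !mulr_ge0 ?addr_ge0// ltW.
have a1 : 0 <= n%:R * `|u| * f by rewrite !mulr_ge0// ltW.
by rewrite /K; lra.
Qed.

Lemma descent_dir_stable x y y0 w : X x -> Y y -> Y y0 ->
  dot w (descent_dir x y y0) < 0 ->
  exists2 r, 0 < r & forall w' z, `|w' - w| < r -> X z -> `|z - x| < r ->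
    dot w' (descent_dir z y y0) < 0.
Proof.
move=> Xx Yy Y0; set d := descent_dir x y y0 => neg.
pose K : R := n%:R * (`|d| + 1) + n%:R * `|w| + 1.
have K0 : 0 < K by rewrite ltr_wpDl// addr_ge0// mulr_ge0// addr_ge0.
pose f := Num.min 1 (- dot w d / K).
have f0 : 0 < f by rewrite lt_min ltr01 divr_gt0//; lra.
have f1 : f <= 1 by rewrite ge_min lexx.
have fK : f * K <= - dot w d by rewrite -ler_pdivlMr// ge_min lexx orbT.
have [r r0 Hr] := descent_dir_eps Xx Yy Y0 f0.
exists (Num.min r f); first by rewrite lt_min r0.
move=> w' z; rewrite lt_min => /andP[_ ww'] Xz; rewrite lt_min => /andP[/(Hr _ Xz) dz _].
move: dz; rewrite -/d; set d' := descent_dir z y y0 => dz.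
have -> : dot w' d' = dot w d + (dot (w' - w) d' + dot (d' - d) w).
  have split_dot (a b p q : V) : dot a b = dot p q + (dot (a - p) b + dot (b - q) p).
    by rewrite !dot_lin (dotC b p) (dotC q p); ring.
  exact: split_dot.
have b1 : `|dot (w' - w) d'| <= n%:R * (`|d| + 1) * f.
  apply: le_trans (dot_norm_le _ _) _; apply: ler_pM => //.
  - rewrite ler_wpM2l//; apply: le_trans (trmx_norm_le _) _.
    have := ler_normD d (d' - d); rewrite addrC subrK; lra.
  - exact: ltW.
have b2 : `|dot (d' - d) w| <= n%:R * `|w| * f.
  apply: le_trans (dot_norm_le _ _) _; apply: ler_pM => //.
  - by rewrite ler_wpM2l//; exact: trmx_norm_le.
  - exact: ltW.
move: b1 b2; rewrite !ler_norml => /andP[_ b1] /andP[_ b2].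
by move: fK; rewrite /K; lra.
Qed.

(** Each unit direction has a slope in [T] with negative derivative, stably in the direction and in
    the base point; compactness of the sphere leaves finitely many. The mean value theorem along the
    c-segment from [x] to [z] then gives the strict decrease. *)
Lemma local_descent (T : set V) xb y0 : X xb -> Y y0 -> T `<=` Y ->
  (forall w, w != 0 -> exists2 y, T y & dot (gx xb y - gx xb y0) w < 0) ->
  exists (l : seq V) (r : R), [/\ 0 < r, (forall y, y \in l -> T y) &
    forall x z, X x -> X z -> `|x - xb| < r -> `|z - xb| < r -> x != z ->
      exists2 y, y \in l & cdiff c y y0 z < cdiff c y y0 x].
Proof.
move=> Xb Y0 TY A1.
pose P (i : V * R) (w : V) := forall z, X z -> `|z - xb| < i.2 ->
  dot w (descent_dir z i.1 y0) < 0.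
have [w /= w1|l Dl Hl] := @compact_finite_cover _ _ _
    [set i : V * R | T i.1 /\ 0 < i.2] P (@unit_sphere_compact R n).
  have [|y Ty Hy] := A1 (- (w *m invmx (M xb y0))).
    rewrite oppr_eq0; apply/eqP => E.
    have : w = 0 by rewrite -[w](mulmxKV (cd_unit H Xb Y0)) E mul0mx.
    by move=> w0; move: w1; rewrite w0 normr0 => /eqP; rewrite eq_sym oner_eq0.
  have [|r r0 Hr] := descent_dir_stable (w := w) Xb (TY _ Ty) Y0.
    by move: Hy; rewrite /descent_dir !dotNr dotC dotMl.
  exists (y, r); first by [].
  by apply/near_normP; exists r => // w' ww' _ z; exact: Hr.
have [i|r0 r00 Hr0] := @pos_seq_min R [seq i.2 | i <- l].
  by move=> /mapP[j /Dl[_ ?] ->].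
have [d d0 Hd] := gy_inverse_continuous H Xb Y0 r00.
have cgy : {for xb, continuous (fun x => gy x y0)}.
  by apply: differentiable_continuous; exact: (cd_dgy H Xb Y0).
have [r rp Hr] := continuous_eps cgy d0.
exists [seq i.1 | i <- l], r; split => //.
  by move=> y /mapP[i /Dl[Ti _] ->].
move=> x z Xx Xz /Hr xr /Hr zr xz.
pose u := gy z y0 - gy x y0.
have u0 : u != 0.
  apply: contra_neq xz => /eqP; rewrite subr_eq0 => /eqP E.
  by apply/esym; exact: (cd_gy_inj H Y0 Xz Xx E).
have un : 0 < `|u| by rewrite normr_gt0.
have [|i il Pi] := Hl (`|u|^-1 *: u).
  by rewrite /= normrZ normfV normr_id mulVf// gt_eqF.
have [Ti i0] := Dl i il; have Yi := TY _ Ti.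
exists i.1; first by apply/mapP; exists i.
have [gam [Xg gE g0 g1]] := c_curve H Xx Xz Y0.
(* The c-segment stays near [xb] because balls are convex in the coordinate [gy _ y0]. *)
have near_g t : 0 <= t <= 1 -> `|gam t - xb| < i.2.
  move=> t01; have Xgt := Xg t t01.
  have ri : r0 <= i.2 by apply: Hr0; apply/mapP; exists i.
  apply: lt_le_trans ri; apply: Hd => //; rewrite gE// -/u.
  have -> : gy x y0 + t *: u - gy xb y0 =
      (1 - t) *: (gy x y0 - gy xb y0) + t *: (gy z y0 - gy xb y0).
    by apply/rowP => k; rewrite !mxE; ring.
  apply: le_lt_trans (ler_normD _ _) _; rewrite !normrZ.
  move: t01 => /andP[t0 t1]; rewrite (ger0_norm t0) ger0_norm ?subr_ge0//.
  have [->|tn] := eqVneq t 0; first by rewrite subr0 mul1r mul0r addr0.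
  have tp : 0 < t by rewrite lt_def tn.
  have h1 : (1 - t) * `|gy x y0 - gy xb y0| <= (1 - t) * d.
    by rewrite ler_wpM2l ?subr_ge0// ltW.
  have h2 : t * `|gy z y0 - gy xb y0| < t * d by rewrite ltr_pM2l.
  lra.
have gi z1 z2 (h1 : X z1) (h2 : X z2) := cd_gy_inj H Y0 h1 h2.
have gd z' (h : X z') := cd_dgy H h Y0.
have gdE z' k (h : X z') := cd_dgyE H k h Y0.
have gU z' (h : X z') := cd_unit H h Y0.
have dF z' (h : X z') := cdiff_differentiable H h Yi Y0.
have cf := curve_continuous (cd_cX H) gi gd gdE gU dF Xg gE.
have df := curve_derive (cd_cX H) gi gd gdE gU dF Xg gE.
have [t t01 E] := MVT ltr01 df cf.
have {}t01 : 0 <= t <= 1 by move: t01; rewrite in_itv/= => /andP[/ltW -> /ltW ->].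
rewrite -g0 -g1 -subr_lt0; move: E; rewrite /= => ->.
rewrite subr0 mulr1 (descent_dirE _ (Xg _ t01) Yi Y0) -/u.
have := Pi _ (Xg _ t01) (near_g t t01).
by rewrite dotZl pmulr_rlt0// invr_gt0.
Qed.

End LocalDescent.

(** * The alternative c-convex function that is not c-convex *)

Section Construction.
Variables (R : realType) (n : nat).
Notation V := 'rV[R]_n.
Variables (X Y : set V) (c : V -> V -> R) (gx gy : V -> V -> V)
  (M : V -> V -> 'M[R]_n).
Hypothesis H : cost_data X Y c gx gy M.
Hypothesis gx_eps : forall x y e, X x -> Y y -> 0 < e ->
  exists2 r, 0 < r & forall z, X z -> `|z - x| < r -> `|gx z y - gx x y| < e.
Hypothesis M_eps : forall x y e, X x -> Y y -> 0 < e ->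
  exists2 r, 0 < r & forall z, X z -> `|z - x| < r -> `|M z y - M x y| < e.
Implicit Types x y : V.

Lemma cross_eps_x x xb y y0 e : X x -> Y y -> Y y0 -> 0 < e ->
  exists2 r, 0 < r & forall z, `|z - x| < r ->
    `|cross c z xb y y0 - cross c x xb y y0| < e.
Proof.
move=> Xx Yy Y0 e0; have e2 : 0 < e / 2 by rewrite divr_gt0.
have [r1 r10 H1] := continuous_eps (cost_continuous_x H Xx Yy) e2.
have [r2 r20 H2] := continuous_eps (cost_continuous_x H Xx Y0) e2.
exists (Num.min r1 r2); first by rewrite lt_min r10.
move=> z; rewrite lt_min => /andP[/H1 + /H2]; rewrite !ltr_norml /cross.
by move=> /andP[h1 h2] /andP[h3 h4]; apply/andP; split; lra.
Qed.

Lemma closed_annulus (Z : set V) xb (a : R) : compact Z ->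
  compact [set z | Z z /\ a <= `|z - xb|].
Proof.
move=> cZ.
have cl : closed [set z : V | a <= `|z - xb|].
  rewrite (_ : [set z | _] = (fun z => `|z - xb|) @^-1` [set r | a <= r])//.
  apply: closed_comp; last exact: closed_ge.
  move=> z _; apply: (@continuous_comp _ _ _ (fun z : V => z - xb) (fun z => `|z|)).
    by apply: continuousB; [exact: cvg_id|exact: cst_continuous].
  exact: norm_continuous.
rewrite (_ : [set z | _ /\ _] = Z `&` [set z | a <= `|z - xb|])//.
exact: compact_closedI.
Qed.

Lemma closed_cball_compact (Z : set V) xb (a b : R) : compact Z ->
  compact [set z | (Z z /\ a <= `|z - xb|) /\ `|z - xb| <= b].
Proof.
move=> cZ.
have cl : closed [set z : V | `|z - xb| <= b].
  rewrite (_ : [set z | _] = (fun z => `|z - xb|) @^-1` [set r | r <= b])//.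
  apply: closed_comp; last exact: closed_le.
  move=> z _; apply: (@continuous_comp _ _ _ (fun z : V => z - xb) (fun z => `|z|)).
    by apply: continuousB; [exact: cvg_id|exact: cst_continuous].
  exact: norm_continuous.
rewrite (_ : [set z | _ /\ _] =
  [set z | Z z /\ a <= `|z - xb|] `&` [set z | `|z - xb| <= b])//.
by apply: compact_closedI => //; exact: closed_annulus.
Qed.

Definition seq_max (f : V -> V -> R) (y0 : V) (l : seq V) (x : V) :=
  foldr (fun y m => Num.max (f y x) m) (f y0 x) l.

Lemma seq_maxE f y0 l x :
  (forall y, y \in y0 :: l -> f y x <= seq_max f y0 l x) /\
  (exists2 y, y \in y0 :: l & seq_max f y0 l x = f y x).
Proof.
rewrite /seq_max; elim: l => [|y l [IH1 [z zl IH2]]] /=.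
  by split; [move=> y; rewrite inE => /eqP ->|exists y0; rewrite ?inE].
split.
  move=> u; rewrite !inE => /or3P[/eqP ->|/eqP ->|ul]; rewrite le_max.
  - by rewrite IH1 ?orbT// mem_head.
  - by rewrite lexx.
  - by rewrite IH1 ?orbT// inE ul orbT.
have [le|le] := leP (f y x) (foldr (fun y m => Num.max (f y x) m) (f y0 x) l).
  by exists z => //; move: zl; rewrite !inE => /orP[->|->]; rewrite ?orbT.
by exists y => //; rewrite !inE eqxx orbT.
Qed.

(** [T] is the set of slopes competing with [y0]: [A0] puts them strictly below it at [x1], [A1]
    places them on every side of it at [xb], and [A2] says that none of them is maximal within [T]
    at a point other than [xb]. *)
Variables (xb x1 y0 : V) (T : set V).
Hypotheses (Xb : X xb) (X1 : X x1) (Y0 : Y y0) (TY : T `<=` Y) (T0 : T !=set0).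
Hypothesis A0 : forall y, T y -> cross c x1 xb y y0 < 0.
Hypothesis A1 : forall w, w != 0 ->
  exists2 y, T y & dot (gx xb y - gx xb y0) w < 0.
Hypothesis A2 : forall y z, T y -> X z -> z != xb ->
  exists2 y', T y' & cross c z xb y y0 < cross c z xb y' y0.

(* [L y] is the c-affine function with slope [y] vanishing at [xb], measured
   relatively to the one with slope [y0]. *)
Let L y x := cross c x xb y y0.

Let L_xb y : L y xb = 0.
Proof. by rewrite /L /cross; ring. Qed.

Let L_y0 x : L y0 x = 0.
Proof. by rewrite /L /cross; ring. Qed.

(** [A2] made quantitative away from [xb], by compactness of the part of [X] at distance at least
    [rho]. *)
Lemma uniform_gap (l : seq V) rho : 0 < rho -> (forall y, y \in l -> T y) ->
  exists (l' : seq V) (eta : R), [/\ 0 < eta, (forall y, y \in l' -> T y) &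
    forall y z, y \in l -> X z -> rho <= `|z - xb| ->
      exists2 y', y' \in l' & L y z + eta <= L y' z].
Proof.
move=> rho0; elim: l => [|y l IH] Tl; first by exists [::], 1; split.
have [|l' [eta [eta0 Tl' Hl']]] := IH.
  by move=> u ul; apply: Tl; rewrite inE ul orbT.
have Ty : T y by apply: Tl; exact: mem_head.
pose P (i : V * R) z := L y z + i.2 <= L i.1 z.
have [z [Xz zr]|k Dk Hk] := @compact_finite_cover _ _ _
    [set i : V * R | T i.1 /\ 0 < i.2] P (@closed_annulus X xb rho (cd_cX H)).
  have zb : z != xb.
    by apply: contraTneq rho0 => zb; rewrite -leNgt; move: zr; rewrite zb subrr normr0.
  have [y' Ty' Ly'] := A2 Ty Xz zb.
  pose e := (L y' z - L y z) / 4.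
  have e0 : 0 < e by rewrite /e /L; lra.
  exists (y', e) => //.
  have [r1 r10 H1] := cross_eps_x xb Xz (TY Ty) Y0 e0.
  have [r2 r20 H2] := cross_eps_x xb Xz (TY Ty') Y0 e0.
  apply/near_normP; exists (Num.min r1 r2); first by rewrite lt_min r10.
  move=> u; rewrite lt_min => /andP[/H1 + /H2 + _]; rewrite !ltr_norml.
  by move=> /andP[h1 h2] /andP[h3 h4]; move: h1 h2 h3 h4; rewrite /P /= /e /L; lra.
have [i|d d0 Hd] := @pos_seq_min R [seq i.2 | i <- k].
  by move=> /mapP[j /Dk[_ ?] ->].
exists ([seq i.1 | i <- k] ++ l'), (Num.min d eta); split.
- by rewrite lt_min d0.
- by move=> u; rewrite mem_cat => /orP[/mapP[i /Dk[Ti _] ->]//|/Tl'].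
- move=> u z; rewrite inE => /orP[/eqP ->|ul] Xz zr.
    have [i ik Pi] := Hk z (conj Xz zr).
    exists i.1; first by rewrite mem_cat map_f.
    have di : d <= i.2 by apply: Hd; exact: map_f.
    have md : Num.min d eta <= d by rewrite ge_min lexx.
    by move: Pi; rewrite /P; lra.
  have [y' y'l Hy'] := Hl' u z ul Xz zr.
  exists y'; first by rewrite mem_cat y'l orbT.
  have md : Num.min d eta <= eta by rewrite ge_min lexx orbT.
  by lra.
Qed.

Lemma alt_not_c_convex : exists phi : V -> R,
  alt_c_convex_fun X Y c phi /\ ~ c_convex_fun X Y c phi.
Proof.
have [t0 Tt0] := T0.
have [l [r [r0 Tl desc]]] := local_descent H gx_eps M_eps Xb Y0 TY A1.
have descL x z : X x -> X z -> `|x - xb| < r -> `|z - xb| < r -> x != z ->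
    exists2 y, y \in l & L y z < L y x.
  move=> Xx Xz xr zr xz; have [y yl] := desc x z Xx Xz xr zr xz.
  by rewrite /cdiff => lt; exists y => //; rewrite /L /cross; lra.
pose l0 := t0 :: l.
have Tl0 y : y \in l0 -> T y by rewrite inE => /orP[/eqP ->|/Tl].
pose rho := r / 2.
have rho0 : 0 < rho by rewrite divr_gt0.
have rhor : rho < r by rewrite /rho; lra.
have [l1 [eta [eta0 Tl1 gap]]] := uniform_gap rho0 Tl0.
pose Phi := seq_max L t0 (l ++ l1).
have PhiE x : (forall y, y \in t0 :: (l ++ l1) -> L y x <= Phi x) /\
    exists2 y, y \in t0 :: (l ++ l1) & Phi x = L y x := seq_maxE L t0 (l ++ l1) x.
have TPhi y : y \in t0 :: (l ++ l1) -> T y.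
  by rewrite inE mem_cat => /or3P[/eqP ->//|/Tl|/Tl1].
have Phi_l0 y x : y \in l0 -> L y x <= Phi x.
  move=> yl; have [+ _] := PhiE x; apply; move: yl.
  by rewrite !inE mem_cat => /orP[->|->]; rewrite ?orbT.
have Phi_l1 y x : y \in l1 -> L y x <= Phi x.
  by move=> yl; have [+ _] := PhiE x; apply; rewrite inE mem_cat yl !orbT.
have eta2 : 0 < eta / 2 by rewrite divr_gt0.
have [rp rp0 Hrp] : exists2 d, 0 < d & forall s, 0 < s < d -> forall y, y \in l0 ->
    forall x, `|x - xb| < s -> `|L y x| < eta / 2.
  apply: seq_common_radius => y yl.
  have [d d0 Hd] := cross_eps_x xb Xb (TY (Tl0 _ yl)) Y0 eta2.
  exists d => // s /andP[s0 sd] x xs.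
  have := Hd x (lt_trans xs sd); rewrite -/(L y x) -/(L y xb) L_xb subr0.
  by [].
pose r' := rp / 2.
have r'0 : 0 < r' by rewrite divr_gt0.
have r'P : 0 < r' < rp by rewrite /r'; lra.
(* Descent from [z] to [xb] provides a slope in [l] with [L y z > 0]; compactness of the annulus
   turns this into a uniform lower bound. *)
have [epA epA0 HA] : exists2 e, 0 < e & forall z, X z -> r' <= `|z - xb| ->
    `|z - xb| <= rho -> e <= Phi z.
  pose P (e : R) z := e <= Phi z.
  have [z [[Xz zr'] zrho]|k Dk Hk] := @compact_finite_cover _ _ _ [set e : R | 0 < e] P
      (@closed_cball_compact X xb r' rho (cd_cX H)).
    have zb : z != xb.
      by apply: contraTneq r'0 => zb; rewrite -leNgt; move: zr'; rewrite zb subrr normr0.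
    have br : `|xb - xb| < r by rewrite subrr normr0.
    have [y yl] := descL z xb Xz Xb (le_lt_trans zrho rhor) br zb.
    rewrite L_xb => Ly; have Ly2 : 0 < L y z / 2 by rewrite divr_gt0.
    exists (L y z / 2) => //.
    have [d d0 Hd] := cross_eps_x xb Xz (TY (Tl _ yl)) Y0 Ly2.
    apply/near_normP; exists d => // u /Hd; rewrite ltr_norml => /andP[h _] _.
    have := @Phi_l0 y u; rewrite inE yl orbT => /(_ isT).
    by rewrite /P; move: h; rewrite -/(L y u) -/(L y z); lra.
  have [e e0 He] := pos_seq_min Dk.
  exists e => // z Xz z1 z2; have [i /He ei] := Hk z (conj (conj Xz z1) z2).
  by rewrite /P; exact: le_trans.
(* [epA] confines the points of [X] where [psi] exceeds [Phi] to the ball of radius [r']; [eta / 2]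
   leaves the other half of [eta] for the variation of [L y] in that ball. *)
pose ep := Num.min epA (eta / 2).
have ep0 : 0 < ep by rewrite lt_min epA0.
have epA_le : ep <= epA by rewrite ge_min lexx.
have ep_eta : ep <= eta / 2 by rewrite ge_min lexx orbT.
pose psi x := if `|x - xb| < rho then Num.max (Phi x) ep else Phi x.
have psi_Phi x : Phi x <= psi x by rewrite /psi; case: ifP => // _; rewrite le_max lexx.
have psi_in x : `|x - xb| < rho -> ep <= psi x.
  by move=> xr; rewrite /psi xr le_max lexx orbT.
have psi_out x : rho <= `|x - xb| -> psi x = Phi x.
  by rewrite /psi ltNge => ->.
pose phi x := - c x y0 + c xb y0 + psi x.
have phiE y k z : (- c z y + (c xb y + k) <= phi z) = (L y z + k <= psi z).
  by rewrite /phi /L /cross; apply/idP/idP => h; lra.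
exists phi; split.
  move=> z0 z1 Xz0 Xz1 x Xx.
  suff [y [k [Yy h0 h1 h]]] : exists y k, [/\ Y y, L y z0 + k <= psi z0,
      L y z1 + k <= psi z1 & psi x <= L y x + k].
    apply: (@le_trans _ _ (- c x y + (c xb y + k))%:E).
      by rewrite lee_fin; move: h; rewrite /phi /L /cross; lra.
    by apply: ereal_sup_ubound; exists y, (c xb y + k); rewrite !phiE.
  have PhiCase : psi x = Phi x -> exists y k, [/\ Y y, L y z0 + k <= psi z0,
      L y z1 + k <= psi z1 & psi x <= L y x + k].
    move=> ->; have [_ [y yl E]] := PhiE x; have PhiL := fun z => (PhiE z).1 y yl.
    exists y, 0; rewrite !addr0; split.
    - exact: TY (TPhi _ yl).
    - exact: le_trans (PhiL _) (psi_Phi _).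
    - exact: le_trans (PhiL _) (psi_Phi _).
    - by rewrite -E.
  have [xout|xin] := leP rho `|x - xb|; first exact: PhiCase (psi_out _ xout).
  have [Phix|Phix] := leP ep (Phi x).
    by apply: PhiCase; rewrite /psi xin max_l.
  have psix : psi x = ep by rewrite /psi xin max_r// ltW.
  have xr' : `|x - xb| < r'.
    rewrite ltNge; apply/negP => /(HA x Xx) /(_ (ltW xin)) h.
    by have := lt_le_trans Phix (le_trans epA_le h); rewrite ltxx.
  have Lx y : y \in l0 -> - (eta / 2) < L y x.
    by move=> yl; have := Hrp r' r'P y yl x xr'; rewrite ltr_norml => /andP[].
  (* The shift [ep - L y x] is less than [eta], and [gap] puts [Phi] at least [eta] above [L y] at
     remote points. *)
  have far y z : y \in l0 -> X z -> rho <= `|z - xb| -> L y z + (ep - L y x) <= psi z.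
    move=> yl Xz zr; rewrite psi_out//; have [y' y'l Hy'] := gap y z yl Xz zr.
    by have := Phi_l1 y' z y'l; have := Lx y yl; lra.
  (* A slope decreasing from [x] to [zi], shifted to the value [ep] at [x], is below [ep] at [zi];
     [far] handles [zo]. *)
  have mixed zi zo : X zi -> X zo -> `|zi - xb| < rho -> rho <= `|zo - xb| ->
      exists2 y, y \in l0 & L y zi + (ep - L y x) <= psi zi /\
        L y zo + (ep - L y x) <= psi zo.
    move=> Xi Xo zi_in zo_out; have := psi_in _ zi_in => pi.
    have [zx|zx] := eqVneq x zi.
      exists t0; first exact: mem_head.
      by split; [rewrite -zx; move: pi; rewrite -zx; lra|apply: far => //; exact: mem_head].
    have [y yl Ly] := descL x zi Xx Xi (lt_trans xin rhor) (lt_trans zi_in rhor) zx.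
    have yl0 : y \in l0 by rewrite inE yl orbT.
    by exists y => //; split; [lra|exact: far].
  have concl y : y \in l0 -> L y z0 + (ep - L y x) <= psi z0 ->
      L y z1 + (ep - L y x) <= psi z1 ->
      exists y k, [/\ Y y, L y z0 + k <= psi z0,
      L y z1 + k <= psi z1 & psi x <= L y x + k].
    move=> yl h0 h1; exists y, (ep - L y x); split => //.
    - exact: TY (Tl0 _ yl).
    - by rewrite psix; lra.
  have [z0out|z0in] := leP rho `|z0 - xb|; have [z1out|z1in] := leP rho `|z1 - xb|.
  - by apply: (concl t0); rewrite ?mem_head//; apply: far => //; exact: mem_head.
  - by have [y yl [h1 h0]] := mixed z1 z0 Xz1 Xz0 z1in z0out; exact: concl h0 h1.
  - by have [y yl [h0 h1]] := mixed z0 z1 Xz0 Xz1 z0in z1out; exact: concl h0 h1.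
  - exists y0, ep; rewrite !L_y0 !add0r psix; split => //; exact: psi_in.
move=> cvx_phi.
have [dl dl0 Hdl] : exists2 d, 0 < d & forall s, 0 < s < d ->
    forall y, y \in t0 :: (l ++ l1) -> forall x, `|x - xb| < s -> L y x < ep.
  apply: seq_common_radius => y yl.
  have [d d0 Hd] := cross_eps_x xb Xb (TY (TPhi _ yl)) Y0 ep0.
  exists d => // s /andP[s0 sd] x xs.
  have := Hd x (lt_trans xs sd); rewrite -/(L y x) -/(L y xb) L_xb subr0.
  by rewrite ltr_norml => /andP[].
pose de := Num.min (dl / 2) rho.
have de0 : 0 < de by rewrite lt_min rho0 andbT divr_gt0.
have de_rho : de <= rho by rewrite ge_min lexx orbT.
have de_dl : de <= dl / 2 by rewrite ge_min lexx.
have psi_flat x : `|x - xb| < de -> psi x = ep.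
  move=> xd; rewrite /psi (lt_le_trans xd de_rho) max_r//.
  have [_ [y yl ->]] := PhiE x; apply/ltW; apply: (Hdl de _ y yl x xd).
  by rewrite de0 /=; lra.
(* [xb] may be a boundary point; [xc] is chosen nearby with inner image, so that a supporting slope
   there is determined. *)
have [xs Xs Is] := inner_gy H Y0.
have [gam [Xg gE _ _]] := c_curve H Xb Xs Y0.
have [d d0 Hd] := gy_inverse_continuous H Xb Y0 de0.
pose u := gy xs y0 - gy xb y0.
have u1 : 0 < `|u| + 1 by rewrite ltr_wpDl.
pose s := Num.min d 1 / (`|u| + 1).
have m0 : 0 < Num.min d 1 by rewrite lt_min d0 ltr01.
have s0 : 0 < s by rewrite divr_gt0.
have su : s * (`|u| + 1) = Num.min d 1 by rewrite divfK// gt_eqF.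
have s1 : s <= 1.
  rewrite ler_pdivrMr// mul1r; apply: (@le_trans _ _ 1); first by rewrite ge_min lexx orbT.
  by rewrite lerDr.
have s01 : 0 <= s <= 1 by rewrite ltW.
pose xc := gam s; have Xc : X xc := Xg s s01.
have xcd : `|xc - xb| < de.
  apply: Hd => //; rewrite gE// addrC addKr normrZ gtr0_norm// -/u.
  have : Num.min d 1 <= d by rewrite ge_min lexx.
  by rewrite -su mulrDr mulr1; lra.
have Ic : inner [set gy x y0 | x in X] (gy xc y0).
  have -> : gy xc y0 = s *: gy xs y0 + (1 - s) *: gy xb y0.
    by rewrite gE//; apply/rowP => i; rewrite !mxE; ring.
  apply: inner_mix => //; [exact: (cd_gy_cvx H Y0)|by exists xb|by exists xs|].
  by rewrite s0.
have cont_c x y : X x -> Y y -> {for y, continuous (fun y' => c x y')}.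
  exact: (cost_continuous_y H).
have [y1 Yy1 sup1] := c_convex_support (cd_cY H) cont_c cvx_phi Xc.
(* Near [xb], [phi] is c-affine of slope [y0]. Another slope would leave a direction at [xc] in
   which [cross] becomes positive, contradicting support. *)
have y1E : y1 = y0.
  apply: (cd_gx_inj H Xc Yy1 Y0); apply/eqP; rewrite -subr_eq0.
  apply/negPn/negP => gn0.
  pose w := - ((gx xc y1 - gx xc y0) *m (invmx (M xc y0))^T).
  have w0 : w != 0.
    rewrite oppr_eq0; apply: contra_neq gn0 => E.
    have uT : (M xc y0)^T \in unitmx by rewrite unitmx_tr (cd_unit H Xc Y0).
    by rewrite -[LHS](mulmxKV uT) -trmx_inv E mul0mx.
  have [_ [x2 X2 <-] Hx2] := Ic w w0.
  have S0 : 0 < slope gx gy M x2 xc y1 y0 by rewrite /slope dotMl -dotNr.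
  have [|d' d'0 Hd'] := cross_sign_x H X2 Xc Yy1 Y0; first by rewrite gt_eqF.
  have [gm [Xgm gmE _ _]] := c_curve H Xc X2 Y0.
  have rem : 0 < de - `|xc - xb| by rewrite subr_gt0.
  have [d2 d20 Hd2] := gy_inverse_continuous H Xc Y0 rem.
  pose u2 := gy x2 y0 - gy xc y0.
  have u21 : 0 < `|u2| + 1 by rewrite ltr_wpDl.
  pose m := Num.min (Num.min d' d2) 1.
  have mm0 : 0 < m by rewrite !lt_min d'0 d20 ltr01.
  have m1 : m <= 1 by rewrite ge_min lexx orbT.
  have md' : m <= d' by rewrite /m !ge_min lexx.
  have md2 : m <= d2 by rewrite /m !ge_min lexx !orbT.
  pose t := m / (`|u2| + 1) / 2.
  have t0' : 0 < t by rewrite !divr_gt0.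
  have tu : t * (`|u2| + 1) * 2 = m.
    by rewrite /t; field; rewrite gt_eqF.
  have un0 : 0 <= t * `|u2| by rewrite mulr_ge0// ltW.
  have t1 : 0 <= t <= 1 by rewrite (ltW t0') /=; lra.
  have td : 0 < t < d' by rewrite t0' /=; lra.
  have := Hd' t (gm t) td (Xgm t t1) (gmE t t1); rewrite pmulr_lgt0//.
  have gmd : `|gm t - xb| < de.
    have : `|gm t - xc| < de - `|xc - xb|.
      apply: Hd2; first exact: Xgm.
      rewrite gmE// addrC addKr normrZ gtr0_norm// -/u2; lra.
    have := ler_normD (gm t - xc) (xc - xb); rewrite addrA subrK; lra.
  have := sup1 (gm t) (Xgm t t1); rewrite /phi !psi_flat// /cross; lra.
(* Support by [y0] forces [ep <= psi x1], while [Phi x1 < 0]. So [x1] is within [rho] of [xb], where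
   descent from [x1] to [xb] makes [Phi x1] positive. *)
have := sup1 x1 X1; rewrite y1E /phi psi_flat// => h.
have ep1 : ep <= psi x1 by lra.
have Phi1 : Phi x1 < 0 by have [_ [y yl ->]] := PhiE x1; exact: A0 (TPhi _ yl).
have [x1out|x1in] := leP rho `|x1 - xb|.
  by move: ep1; rewrite psi_out//; lra.
have x1b : x1 != xb.
  by apply: contraTneq (A0 Tt0) => ->; rewrite -/(L t0 xb) L_xb ltxx.
have br : `|xb - xb| < r by rewrite subrr normr0.
have [y yl] := descL x1 xb X1 Xb (lt_trans x1in rhor) br x1b.
rewrite L_xb => Ly; have := @Phi_l0 y x1; rewrite inE yl orbT => /(_ isT).
lra.
Qed.

End Construction.

(** * Competing slopes from a violated first-order condition *)

Section NotLoeper.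
Variables (R : realType) (n : nat).
Notation V := 'rV[R]_n.
Variables (X Y : set V) (c : V -> V -> R) (gx gy : V -> V -> V)
  (M : V -> V -> 'M[R]_n).
Hypothesis H : cost_data X Y c gx gy M.
Hypothesis gx_eps : forall x y e, X x -> Y y -> 0 < e ->
  exists2 r, 0 < r & forall z, X z -> `|z - x| < r -> `|gx z y - gx x y| < e.
Hypothesis M_eps : forall x y e, X x -> Y y -> 0 < e ->
  exists2 r, 0 < r & forall z, X z -> `|z - x| < r -> `|M z y - M x y| < e.
Implicit Types x y : V.

Lemma cross_eps_y x xb y y0 e : X x -> X xb -> Y y -> 0 < e ->
  exists2 d, 0 < d & forall z, Y z -> `|gx xb z - gx xb y| < d ->
    `|cross c x xb z y0 - cross c x xb y y0| < e.
Proof.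
move=> Xx Xb Yy e0; have e2 : 0 < e / 2 by rewrite divr_gt0.
have [d1 d10 H1] := cost_eps_gx H Xb Xx Yy e2.
have [d2 d20 H2] := cost_eps_gx H Xb Xb Yy e2.
exists (Num.min d1 d2); first by rewrite lt_min d10.
move=> z Yz; rewrite lt_min => /andP[/(H1 _ Yz) + /(H2 _ Yz)].
rewrite !ltr_norml /cross.
by move=> /andP[h1 h2] /andP[h3 h4]; apply/andP; split; lra.
Qed.

(* A violation of [cross_condition] gives a point [pt] of a c-segment at which
   the dual quasi-convexity fails; mixing everything with an interior point of
   the image of [Y] makes the set [T] of competing slopes open. *)
Lemma not_cross_condition_alt : ~ cross_condition X Y c gx gy M ->
  exists phi : V -> R, alt_c_convex_fun X Y c phi /\ ~ c_convex_fun X Y c phi.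
Proof.
move=> nCC; have [x [xb [y [y0 [Xx Xb Yy Y0 [cr sl]]]]]] : exists x xb y y0,
    [/\ X x, X xb, Y y, Y y0 &
      cross c x xb y y0 <= 0 /\ 0 < slope gx gy M x xb y y0].
  apply: contrapT => no; apply: nCC => x xb y y0 Xx Xb Yy Y0 cr.
  by rewrite leNgt; apply/negP => sl; apply: no; exists x, xb, y, y0.
have gxv := cd_gx_cvx H Xb.
pose P := [set gx xb y | y in Y].
have xxb : x != xb.
  apply: contraTneq sl => ->; rewrite slope_dirE /slope_dir subrr mul0mx oppr0 dot0r.
  by rewrite ltxx.
(* [lam] vanishes at [y0], is nonpositive at [y] and positive at the intermediate slope [yt]. *)
pose lam z := cross c x xb z y0.
have lam0 : lam y0 = 0 by rewrite /lam /cross; ring.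
have [|d d0 Hd] := cross_sign_y H Xx Xb Yy Y0; first by rewrite gt_eqF.
have [gam [Yg gE _ _]] := c_curve_y H Xb Y0 Yy.
have m0 : 0 < Num.min d 1 by rewrite lt_min d0 ltr01.
have md : Num.min d 1 <= d by rewrite ge_min lexx.
have m1 : Num.min d 1 <= 1 by rewrite ge_min lexx orbT.
pose s := Num.min d 1 / 2.
have sd : 0 < s < d by rewrite /s; lra.
have s01 : 0 <= s <= 1 by rewrite /s; lra.
have s0 : 0 < s by case/andP: sd.
have s1 : 0 < 1 - s by rewrite /s; lra.
pose yt := gam s; have Yt : Y yt := Yg s s01.
have lamt : 0 < lam yt by have := Hd s yt sd Yt (gE s s01); rewrite pmulr_lgt0.
have l2 : 0 < lam yt / 2 by rewrite divr_gt0.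
have [ys Ys Is] := inner_gx H Xb.
pose ps := gx xb ys; pose pt := gx xb yt; pose p0 := gx xb y0; pose p1 := gx xb y.
have [da da0 Ha] := cross_eps_y y0 Xx Xb Y0 l2.
have [db db0 Hb] := cross_eps_y y0 Xx Xb Yy l2.
have [dt dt0 Ht] := cross_eps_y y0 Xx Xb Yt l2.
pose de := Num.min da (Num.min db dt).
have de0 : 0 < de by rewrite !lt_min da0 db0.
(* [D] bounds the distances from [ps] to [p0], [p1] and [pt], so mixing with weight [tau] moves each
   of these by at most [de / 2]. *)
pose D := `|ps - p0| + `|ps - p1| + `|ps - pt| + 1.
have D0 : 0 < D by rewrite ltr_wpDl// !addr_ge0.
pose tau := Num.min (de / 2 / D) (1 / 2).
have tau0 : 0 < tau by rewrite lt_min !divr_gt0.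
have tau1 : tau <= 1 / 2 by rewrite ge_min lexx orbT.
have tauD : tau * D <= de / 2 by rewrite -ler_pdivlMr// ge_min lexx.
have tau01 : 0 <= tau <= 1 by rewrite ltW//=; lra.
have tau01' : 0 < tau <= 1 by rewrite tau0 /=; lra.
have Pps : P ps by exists ys.
have Ppt : P pt by exists yt.
have [yq Yq yqE] : P (tau *: ps + (1 - tau) *: pt) by exact: gxv.
have near_p p : `|ps - p| <= D -> `|tau *: ps + (1 - tau) *: p - p| <= de / 2.
  move=> pD; have -> : tau *: ps + (1 - tau) *: p - p = tau *: (ps - p).
    by apply/rowP => i; rewrite !mxE; ring.
  rewrite normrZ gtr0_norm//; apply: le_trans tauD.
  by rewrite ler_pM2l.
have np0 := normr_ge0 (ps - p0); have np1 := normr_ge0 (ps - p1).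
have npt := normr_ge0 (ps - pt).
have lamq : lam yt / 2 < lam yq.
  have : `|lam yq - lam yt| < lam yt / 2.
    apply: Ht => //; rewrite yqE.
    have := near_p pt; rewrite /D => /(_ ltac:(lra)) h.
    have : de <= dt by rewrite /de !ge_min lexx !orbT.
    by move: h; rewrite -/pt; lra.
  by rewrite ltr_norml => /andP[+ _]; lra.
pose T := [set z | [/\ Y z, inner P (gx xb z) & lam z < lam yq]].
have TA1 w : w != 0 -> exists2 z, T z & dot (gx xb z - gx xb yq) w < 0.
  move=> w0; have [|_ [yb Yb <-]] := Is (- w); first by rewrite oppr_eq0.
  set b := gx xb yb; rewrite dotNr oppr_gt0 -/ps => Hb'.
  (* [pt] lies between [p0] and [p1], so one of these is on the nonpositive side for [w]. Replacing
     [ps] by [q], slightly towards [b], makes the inequality strict. *)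
  have [p [Pp pD pw lamp]] : exists p, [/\ P p, `|ps - p| <= D, dot (p - pt) w <= 0 &
      forall z, Y z -> `|gx xb z - p| < de -> lam z < lam yt / 2].
    have E0 : p0 - pt = - s *: (p1 - p0).
      by rewrite /pt /yt gE//; exact: sub_segment0.
    have E1 : p1 - pt = (1 - s) *: (p1 - p0).
      by rewrite /pt /yt gE//; exact: sub_segment1.
    have [le|lt] := leP 0 (dot (p1 - p0) w).
      exists p0; split; [by exists y0|by rewrite /D; lra| |].
        by rewrite E0 dotZl mulNr oppr_le0 mulr_ge0// ltW.
      move=> z Yz zd; have : `|lam z - lam y0| < lam yt / 2.
        by apply: Ha => //; apply: lt_le_trans zd _; rewrite ge_min lexx.
      by rewrite lam0 subr0 ltr_norml => /andP[].
    exists p1; split; [by exists y|by rewrite /D; lra| |].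
      by rewrite E1 dotZl pmulr_rle0// ltW.
    move=> z Yz zd; have : `|lam z - lam y| < lam yt / 2.
      by apply: Hb => //; apply: lt_le_trans zd _; rewrite !ge_min lexx orbT.
    by rewrite ltr_norml => /andP[_]; move: cr; rewrite -/(lam y); lra.
  pose ka := Num.min (de / 2 / (`|b - ps| + 1)) (1 / 2).
  have n1 : 0 < `|b - ps| + 1 by rewrite ltr_wpDl.
  have ka0 : 0 < ka by rewrite lt_min !divr_gt0.
  have ka1 : ka <= 1 / 2 by rewrite ge_min lexx orbT.
  have kab : ka * (`|b - ps| + 1) <= de / 2 by rewrite -ler_pdivlMr// ge_min lexx.
  pose q := (1 - ka) *: ps + (1 - (1 - ka)) *: b.
  have Pb : P b by exists yb.
  have ka01 : 0 < 1 - ka <= 1 by apply/andP; split; lra.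
  have Iq : inner P q by exact: inner_mix.
  have Pq : P q by apply: gxv => //; apply/andP; split; lra.
  have [z Yz zE] : P (tau *: q + (1 - tau) *: p) by exact: gxv.
  have qE : q = ps + ka *: (b - ps).
    by rewrite /q; apply/rowP => i; rewrite !mxE; ring.
  exists z.
    split => //; first by rewrite zE; exact: inner_mix.
    apply: lt_trans lamq; apply: lamp => //; rewrite zE.
    have -> : tau *: q + (1 - tau) *: p - p =
        (tau *: ps + (1 - tau) *: p - p) + (tau * ka) *: (b - ps).
      by rewrite qE; apply/rowP => i; rewrite !mxE; ring.
    apply: le_lt_trans (ler_normD _ _) _; have h := near_p p pD.
    rewrite normrZ gtr0_norm ?mulr_gt0//.
    have hb : ka * `|b - ps| < de / 2 by move: kab; rewrite mulrDr mulr1; lra.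
    have nb : 0 <= ka * `|b - ps| by rewrite mulr_ge0// ltW.
    have : tau * (ka * `|b - ps|) <= 1 * (ka * `|b - ps|).
      by rewrite ler_wpM2r//; lra.
    by rewrite mulrA; lra.
  rewrite zE yqE.
  have -> : tau *: q + (1 - tau) *: p - (tau *: ps + (1 - tau) *: pt) =
      (tau * ka) *: (b - ps) + (1 - tau) *: (p - pt).
    by rewrite qE; apply/rowP => i; rewrite !mxE; ring.
  have tk : 0 < tau * ka by rewrite mulr_gt0.
  have h1 : tau * ka * dot (b - ps) w < 0 by rewrite pmulr_rlt0.
  have h2 : (1 - tau) * dot (p - pt) w <= 0 by rewrite mulr_ge0_le0//; lra.
  by rewrite dotDl !dotZl; lra.
apply: (@alt_not_c_convex R n X Y c gx gy M H gx_eps M_eps xb x yq T Xb Xx Yq).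
- by move=> z [].
- have [z Tz _] := TA1 _ (slope_dir_neq0 H Xx Xb Y0 xxb).
  by exists z.
- by move=> z [_ _]; rewrite /lam /cross; lra.
- exact: TA1.
move=> z u [Yz Iz lz] Xu ub.
(* [z] is inner, so some direction has positive [slope] at [u]; a short move in it raises [cross] at
   [u] and stays in [T]. *)
have [_ [z2 Y2 <-] Hz2] := Iz _ (slope_dir_neq0 H Xu Xb Yz ub).
have S0 : 0 < slope gx gy M u xb z2 z by rewrite slope_dirE.
have [|d1 d10 Hd1] := cross_sign_y H Xu Xb Y2 Yz; first by rewrite gt_eqF.
have [gm [Ygm gmE _ _]] := c_curve_y H Xb Yz Y2.
have gap : 0 < lam yq - lam z by rewrite subr_gt0.
have [d2 d20 Hd2] := cross_eps_y y0 Xx Xb Yz gap.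
pose u2 := gx xb z2 - gx xb z.
have u21 : 0 < `|u2| + 1 by rewrite ltr_wpDl.
pose m := Num.min (Num.min d1 d2) 1.
have mm0 : 0 < m by rewrite !lt_min d10 d20 ltr01.
have mle1 : m <= 1 by rewrite ge_min lexx orbT.
have md1 : m <= d1 by rewrite /m !ge_min lexx.
have md2 : m <= d2 by rewrite /m !ge_min lexx !orbT.
pose t := m / (`|u2| + 1) / 2.
have t0' : 0 < t by rewrite !divr_gt0.
have tu : t * (`|u2| + 1) * 2 = m by rewrite /t; field; rewrite gt_eqF.
have un0 : 0 <= t * `|u2| by rewrite mulr_ge0// ltW.
have t1 : 0 <= t <= 1 by rewrite (ltW t0') /=; lra.
have td : 0 < t < d1 by rewrite t0' /=; lra.
exists (gm t); last first.
  have := Hd1 t (gm t) td (Ygm t t1) (gmE t t1); rewrite pmulr_lgt0//.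
  by rewrite /cross; lra.
split; first exact: Ygm.
  have -> : gx xb (gm t) = (1 - t) *: gx xb z + (1 - (1 - t)) *: gx xb z2.
    by rewrite gmE//; apply/rowP => i; rewrite !mxE; ring.
  apply: inner_mix => //; [by exists z2|by exists z|].
  by apply/andP; split; lra.
have : `|lam (gm t) - lam z| < lam yq - lam z.
  apply: Hd2; first exact: Ygm.
  rewrite gmE// addrC addKr normrZ gtr0_norm// -/u2; lra.
by rewrite ltr_norml => /andP[_]; lra.
Qed.

End NotLoeper.

(** * Abstract cost data from the hypotheses, and the theorem *)

Section CostData.
Variables (R : realType) (n : nat).
Notation V := 'rV[R]_n.

Lemma diff_coord (G : V -> V) (z : V) (i j : 'I_n) : differentiable G z ->
  'd G z (delta_mx 0 i) 0 j = 'd (fun z => G z 0 j) z (delta_mx 0 i).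
Proof.
move=> dG; rewrite -deriveE// derive_mx ?mxE; last exact: diff_derivable.
have dGj : differentiable (fun z => G z 0 j) z.
  exact: (differentiable_comp dG (differentiable_coord _ 0 j)).
by rewrite (deriveE _ dGj).
Qed.

Lemma within_prod_eps (W : normedModType R) (f : V -> V -> W) (X Y : set V) :
  {within X `*` Y, continuous (fun p => f p.1 p.2)} ->
  forall x y e, X x -> Y y -> 0 < e ->
  exists2 r, 0 < r & forall z, X z -> `|z - x| < r -> `|f z y - f x y| < e.
Proof.
move=> /subspace_continuousP cf x y e Xx Yy e0.
have := cf (x, y) (conj Xx Yy) _ (near_norm_lt (f x y) e0).
move=> [[A B] /= [nA nB] AB].
have /near_normP[r r0 Hr] := nA.
exists r => // z Xz zr; apply: (AB (z, y)) => //; split => /=; first exact: Hr.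
exact: nbhs_singleton nB.
Qed.

Variables (X Y : set V) (c : V -> V -> R).

(** The symmetry clause of [C2_on] makes both mixed derivatives one matrix up to transposition. The
    minus signs in the c-images disappear by negation, which preserves injectivity and convexity. *)
Lemma cost_dataP : compact X -> X° !=set0 -> compact Y -> Y° !=set0 ->
  C2_on X Y c -> bi_twist X Y c -> non_degenerate X Y c ->
  c_convex_wrt_X X Y c -> c_convex_wrt_Y X Y c ->
  cost_data X Y c (gradx c) (grady c) (Dxy c).
Proof.
move=> cX iX cY iY [dx dy dgx dgy [_ _ _ _ sym]] [tx ty] nd vX vY.
apply: CostData.
- exact: cX.
- exact: iX.
- exact: cY.
- exact: iY.
- exact: dx.
- by move=> x y k _ _; exact: diff_dot.
- exact: dy.
- by move=> x y k _ _; exact: diff_dot.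
- exact: dgy.
- move=> x y k Xx Yy; rewrite diff_mulmx; congr (_ *m _).
  rewrite sym//; apply/matrixP => i j.
  by rewrite !mxE; exact: (diff_coord _ _ (dgy x y Xx Yy)).
- exact: dgx.
- move=> x y k Xx Yy; rewrite diff_mulmx; congr (_ *m _).
  apply/matrixP => i j.
  by rewrite !mxE; exact: (diff_coord _ _ (dgx x y Xx Yy)).
- exact: nd.
- by move=> y x1 x2 Yy X1 X2 e; exact: (ty y Yy x1 x2 X1 X2 (congr1 -%R e)).
- by move=> x y1 y2 Xx Y1 Y2 e; exact: (tx x Xx y1 y2 Y1 Y2 (congr1 -%R e)).
- move=> y Yy _ _ t [x1 X1 <-] [x2 X2 <-] t01.
  have /convex_set_cvx vXy := vX y Yy.
  have m1 : cimX X c y (- grady c x1 y) by exists x1.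
  have m2 : cimX X c y (- grady c x2 y) by exists x2.
  have [x Xx xE] := vXy _ _ t m1 m2 t01.
  by exists x => //; apply: oppr_inj; rewrite xE !scalerN opprD.
- move=> x Xx _ _ t [y1 Y1 <-] [y2 Y2 <-] t01.
  have /convex_set_cvx vYx := vY x Xx.
  have m1 : cimY Y c x (- gradx c x y1) by exists y1.
  have m2 : cimY Y c x (- gradx c x y2) by exists y2.
  have [y Yy yE] := vYx _ _ t m1 m2 t01.
  by exists y => //; apply: oppr_inj; rewrite yE !scalerN opprD.
Qed.

End CostData.

Theorem theorem1p1 (R : realType) (n : nat) (X Y : set 'rV[R]_n)
  (c : 'rV[R]_n -> 'rV[R]_n -> R) :
  compact X -> X° !=set0 -> compact Y -> Y° !=set0 ->
  C2_on X Y c -> bi_twist X Y c -> non_degenerate X Y c ->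
  c_convex_wrt_X X Y c -> c_convex_wrt_Y X Y c ->
  (Loeper X Y c ->
     forall phi : 'rV[R]_n -> R, c_convex_fun X Y c phi <-> alt_c_convex_fun X Y c phi) /\
  (~ Loeper X Y c ->
     exists phi : 'rV[R]_n -> R, alt_c_convex_fun X Y c phi /\ ~ c_convex_fun X Y c phi).
Proof.
move=> cX iX cY iY C2 tw nd vX vY.
have H := cost_dataP cX iX cY iY C2 tw nd vX vY.
have gyE x y : grady c x y = grady c x y by [].
split=> [L phi|nL].
  split; first exact: c_convex_alt.
  by move=> alt; exact: (alt_c_convex H gyE L alt).
have [_ _ _ _ [kgx _ kD _ _]] := C2.
apply: (not_cross_condition_alt H (within_prod_eps kgx) (within_prod_eps kD)).
by move=> CC; apply: nL; exact: (cross_condition_Loeper H gyE CC).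
Qed.
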